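(* Let $n,d\in\mathbb{N}$. Then there is a prime $p_0=p_0(n,d)$ such that for every algebraically closed field $k$ with $\operatorname{char}(k)\geq p_0$, any algebraic $k$-group of complexity at most $d$ (with respect to $n$ variables) is smooth.
   Context: An algebraic $k$-group is an affine $k$-group scheme of finite type (not assumed smooth). Let $S=k[x_1,\dots,x_n]$, and identify $S^{\otimes 2}$ with the polynomial ring in $2n$ variables. A Hopf quadruple is $(\mathcal{B},\Delta,\sigma,\epsilon)$, where $\mathcal{B}$ is a list of elements of $S$ generating an ideal $I$, and $\Delta\colon S\to S^{\otimes 2}$, $\sigma\colon S\to S$, $\epsilon\colon S\to k$ are $k$-algebra homomorphisms, such that $S/I$ equipped with the maps induced by $\Delta,\sigma,\epsilon$ (comultiplication, antipode, counit) is a Hopf algebra. It has complexity at most $d$ if the elements of $\mathcal{B}$ have total degree at most $d$ and each of $\Delta,\sigma,\epsilon$ sends each $x_i$ to a polynomial of total degree at most $d$. An algebraic $k$-group has complexity at most $d$ (with respect to $n$ variables) if it is the group $\operatorname{Spec}(S/I)$ described by a Hopf quadruple of complexity at most $d$. *)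

(* Defs.v *)
From HB Require Import structures.
From mathcomp Require Import all_boot all_order all_algebra.
From mathcomp Require Import ring_quotient generic_quotient.
From mathcomp Require Import boolp.
From mathcomp Require Export mpoly.

Set Implicit Arguments.
Unset Strict Implicit.
Unset Printing Implicit Defensive.

Import GRing.Theory.
Local Open Scope ring_scope.
Local Open Scope quotient_scope.

Section GeneratedIdeal.
Variable R : comNzRingType.

Definition in_gen_ideal (B : seq R) (f : R) : Prop :=
  exists c : 'I_(size B) -> R, f = \sum_(i < size B) c i * B`_i.

Lemma in_gen_ideal0 B : in_gen_ideal B 0.
Proof. by exists (fun=> 0); rewrite big1 // => i _; rewrite mul0r. Qed.

Lemma in_gen_idealB B f g :
  in_gen_ideal B f -> in_gen_ideal B g -> in_gen_ideal B (f - g).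
Proof.
move=> [c ->] [e ->]; exists (fun i => c i - e i).
by rewrite -sumrB; apply: eq_bigr => i _; rewrite mulrBl.
Qed.

Lemma in_gen_idealM B f g : in_gen_ideal B g -> in_gen_ideal B (f * g).
Proof.
move=> [c ->]; exists (fun i => f * c i).
by rewrite mulr_sumr; apply: eq_bigr => i _; rewrite mulrA.
Qed.

(* f = g modulo the ideal generated by B *)
Definition eq_mod_gen (B : seq R) (f g : R) : Prop := in_gen_ideal B (f - g).

End GeneratedIdeal.

Section TensorPowers.
Variable k : fieldType.

(* The two structure maps of the coproduct k[x_1..x_m] (x) k[y_1..y_n],
   identified with the polynomial ring in m + n variables (x first, then y). *)
Definition tens_inl m n (f : {mpoly k[m]}) : {mpoly k[m + n]} :=
  f \mPo [tuple 'X_(lshift n i) | i < m].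

Definition tens_inr m n (f : {mpoly k[n]}) : {mpoly k[m + n]} :=
  f \mPo [tuple 'X_(rshift m i) | i < n].

(* For k-algebra homomorphisms u and v, the k-algebra homomorphism
   a (x) b |-> u a * v b; it only depends on the images of the variables. *)
Definition tens_elim m n r (u : {mpoly k[m]} -> {mpoly k[r]})
    (v : {mpoly k[n]} -> {mpoly k[r]}) (p : {mpoly k[m + n]}) : {mpoly k[r]} :=
  p \mPo [tuple of [tuple u 'X_i | i < m] ++ [tuple v 'X_i | i < n]].

Section Factors.
Variable n : nat.

(* a |-> a (x) 1 (x) 1, 1 (x) a (x) 1 and 1 (x) 1 (x) a *)
Definition tens3_1 (f : {mpoly k[n]}) : {mpoly k[n + n + n]} :=
  tens_inl n (tens_inl n f).
Definition tens3_2 (f : {mpoly k[n]}) : {mpoly k[n + n + n]} :=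
  tens_inl n (tens_inr n f).
Definition tens3_3 (f : {mpoly k[n]}) : {mpoly k[n + n + n]} :=
  tens_inr (n + n) f.

(* With I = (B) and S = k[x_1..x_n], the quotient of S (x) S by the ideal
   generated by gens2 B is (S/I) (x) (S/I), and similarly for gens3 B. *)
Definition gens2 (B : seq {mpoly k[n]}) : seq {mpoly k[n + n]} :=
  map (@tens_inl n n) B ++ map (@tens_inr n n) B.
Definition gens3 (B : seq {mpoly k[n]}) : seq {mpoly k[n + n + n]} :=
  map tens3_1 B ++ map tens3_2 B ++ map tens3_3 B.

End Factors.
End TensorPowers.

Section HopfQuadruple.
Variables (k : fieldType) (n : nat).
Local Notation S := {mpoly k[n]}.
Local Notation S2 := {mpoly k[n + n]}.

(* Delta, sigma, eps descend to S/I and make it a Hopf algebra: the axioms are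
   the usual identities between maps out of S/I, read on representatives. *)
Record hopf_axioms (B : seq S) (Delta : S -> S2) (sigma : S -> S) (eps : S -> k)
    : Prop := HopfAxioms {
  hopf_comul_ideal : forall f, in_gen_ideal B f -> in_gen_ideal (gens2 B) (Delta f);
  hopf_antip_ideal : forall f, in_gen_ideal B f -> in_gen_ideal B (sigma f);
  hopf_counit_ideal : forall f, in_gen_ideal B f -> eps f = 0;
  (* (Delta (x) id) Delta = (id (x) Delta) Delta *)
  hopf_coassoc : forall f, eq_mod_gen (gens3 B)
    (tens_elim (fun g => tens_inl n (Delta g)) (@tens3_3 k n) (Delta f))
    (tens_elim (@tens3_1 k n)
       (fun g => tens_elim (@tens3_2 k n) (@tens3_3 k n) (Delta g)) (Delta f));
  (* (eps (x) id) Delta = id = (id (x) eps) Delta *)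
  hopf_counitl : forall f,
    eq_mod_gen B (tens_elim (fun g => (eps g)%:MP) id (Delta f)) f;
  hopf_counitr : forall f,
    eq_mod_gen B (tens_elim id (fun g => (eps g)%:MP) (Delta f)) f;
  (* mult (sigma (x) id) Delta = eps = mult (id (x) sigma) Delta *)
  hopf_antipl : forall f,
    eq_mod_gen B (tens_elim sigma id (Delta f)) (eps f)%:MP;
  hopf_antipr : forall f,
    eq_mod_gen B (tens_elim id sigma (Delta f)) (eps f)%:MP
}.

Record hopf_quadruple := HopfQuadruple {
  hgens : seq S;
  hcomul : {lrmorphism S -> S2};
  hantip : {lrmorphism S -> S};
  hcounit : {lrmorphism S -> k^o};
  hopfP : hopf_axioms hgens hcomul hantip hcounit
}.

(* The total degree of f is at most d iff msize f <= d.+1 (with msize 0 = 0).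
   The values of the counit are viewed as constant polynomials. *)
Definition complexity_le (d : nat) (H : hopf_quadruple) : Prop :=
  [/\ forall f, f \in hgens H -> (msize f <= d.+1)%N,
      forall i : 'I_n, (msize (hcomul H 'X_i) <= d.+1)%N,
      forall i : 'I_n, (msize (hantip H 'X_i) <= d.+1)%N &
      forall i : 'I_n, (msize ((hcounit H 'X_i : k)%:MP : S) <= d.+1)%N].

Definition hopf_ideal (H : hopf_quadruple) : S -> bool :=
  fun f => `[< in_gen_ideal (hgens H) f >].

Lemma hopf_idealP H : idealr_closed (hopf_ideal H).
Proof.
split.
- exact/asboolP/in_gen_ideal0.
- apply/negP => /asboolP h1.
  have := hopf_counit_ideal (hopfP H) h1.
  by rewrite rmorph1 => /eqP; rewrite oner_eq0.
- move=> a u v /asboolP hu /asboolP hv; apply/asboolP.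
  have hNv : in_gen_ideal (hgens H) (- v).
    by rewrite -sub0r; apply: in_gen_idealB => //; exact: in_gen_ideal0.
  by rewrite -[v]opprK; apply: in_gen_idealB => //; exact: in_gen_idealM.
Qed.

HB.instance Definition _ (H : hopf_quadruple) :=
  isIdealr.Build S (hopf_ideal H) (hopf_idealP H).

Definition hopf_idealr (H : hopf_quadruple) : idealr {mpoly k[n]} :=
  Idealr.clone _ (hopf_ideal H) _.

(* S/I *)
Definition coord_ring (H : hopf_quadruple) : Type :=
  {ideal_quot (hopf_idealr H)}.

Section CoordRing.
Variable H : hopf_quadruple.
Local Notation A := (coord_ring H).

HB.instance Definition _ := GRing.ComNzRing.on A.

Definition coord_pi (f : S) : A := \pi_({ideal_quot (hopf_idealr H)}) f.

Lemma coord_pi_surj (a : A) : exists f, coord_pi f = a.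
Proof. by exists (repr a); exact: reprK. Qed.

Lemma coord_pi_eq f g : coord_pi f = coord_pi g <-> eq_mod_gen (hgens H) f g.
Proof.
have E : (coord_pi f == coord_pi g) = `[< eq_mod_gen (hgens H) f g >].
  by rewrite /coord_pi -Quotient.idealrBE.
by split=> [/eqP|h]; [rewrite E => /asboolP | apply/eqP; rewrite E; apply/asboolP].
Qed.

Lemma coord_piD f g : coord_pi (f + g) = coord_pi f + coord_pi g.
Proof. exact: Quotient.pi_add. Qed.

Lemma coord_piM f g : coord_pi (f * g) = coord_pi f * coord_pi g.
Proof. exact: Quotient.pi_mul. Qed.

Lemma coord_pi1 : coord_pi 1 = 1.
Proof. by rewrite /coord_pi -[RHS]/(Quotient.one (hopf_idealr H)) /Quotient.one; unlock. Qed.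

Definition coord_scale (a : k) (x : A) : A := coord_pi a%:MP * x.

Lemma coord_scaleA a b x :
  coord_scale a (coord_scale b x) = coord_scale (a * b) x.
Proof. by rewrite /coord_scale mulrA -coord_piM -mpolyCM. Qed.

Lemma coord_scale1 : left_id 1 coord_scale.
Proof. by move=> x; rewrite /coord_scale mpolyC1 coord_pi1 mul1r. Qed.

Lemma coord_scaleDr : right_distributive coord_scale +%R.
Proof. by move=> a x y; rewrite /coord_scale mulrDr. Qed.

Lemma coord_scaleDl x : {morph coord_scale^~ x : a b / a + b}.
Proof. by move=> a b; rewrite /coord_scale mpolyCD coord_piD mulrDl. Qed.

HB.instance Definition _ := GRing.Zmodule_isLmodule.Build k A
  coord_scaleA coord_scale1 coord_scaleDr coord_scaleDl.

Lemma coord_scaleAl (a : k) (x y : A) : a *: (x * y) = (a *: x) * y.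
Proof. exact: mulrA. Qed.

HB.instance Definition _ := GRing.Lmodule_isLalgebra.Build k A coord_scaleAl.
HB.instance Definition _ := GRing.Lalgebra_isComAlgebra.Build k A.

Lemma coord_piZ a f : coord_pi (a *: f) = a *: coord_pi f.
Proof. by rewrite -mul_mpolyC coord_piM. Qed.

Lemma coord_pi_zmod_morphism : zmod_morphism coord_pi.
Proof.
by move=> f g; rewrite coord_piD -[- g]scaleN1r coord_piZ scaleN1r.
Qed.

Lemma coord_pi_monoid_morphism : monoid_morphism coord_pi.
Proof. by split; [exact: coord_pi1 | exact: coord_piM]. Qed.

HB.instance Definition _ :=
  GRing.isZmodMorphism.Build S A coord_pi coord_pi_zmod_morphism.
HB.instance Definition _ :=
  GRing.isMonoidMorphism.Build S A coord_pi coord_pi_monoid_morphism.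
HB.instance Definition _ := GRing.isScalable.Build k S A *:%R coord_pi coord_piZ.

End CoordRing.
End HopfQuadruple.

Section Smoothness.
Variable k : fieldType.

Definition finitely_presented (A : comAlgType k) : Prop :=
  exists (m : nat) (B : seq {mpoly k[m]}) (q : {lrmorphism {mpoly k[m]} -> A}),
    (forall a, exists f, q f = a) /\ (forall f, q f = 0 <-> in_gen_ideal B f).

(* Infinitesimal lifting: D = C/N with N = ker q an ideal of square zero. *)
Definition formally_smooth (A : comAlgType k) : Prop :=
  forall (C D : comAlgType k) (q : {lrmorphism C -> D}),
    (forall y, exists x, q x = y) ->
    (forall x y, q x = 0 -> q y = 0 -> x * y = 0) ->
    forall u : {lrmorphism A -> D},
      exists v : {lrmorphism A -> C}, forall a, q (v a) = u a.

(* Smoothness of Spec A over k (EGA IV 17.3.1) *)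
Definition smooth (A : comAlgType k) : Prop :=
  finitely_presented A /\ formally_smooth A.

End Smoothness.

(* Main.v *)
(** Only the degrees of the generators matter.  Let I be the ideal, m the
    maximal ideal of the unit e, and g a system of n linear combinations of the
    generators whose differentials at e span those of all of I, normalised so
    that its Jacobian matrix at e is a projection fixing g.

    Cartier: the invariant derivations preserve I and span the tangent space
    at e; composing them into the Euler operator, which is multiplication by N
    on m^N / m^(N+1), gives I <= (g) + m^N for N <= p by induction on N.

    Uniformity: b lies in (g) + m^N iff b vanishes to order N at the N-th
    Newton iterate for the system g = 0.  The coefficients involved are integer
    polynomials in those of g, b and e, so Hilbert's basis theorem over Z
    yields N0 = N0(n, d) such that b in (g) + m^N0 implies b in (g) + m^N for
    all N; then b is in (g) near e by Krull's intersection theorem.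

    Hence, as soon as p > N0, I is generated near e by g, so that the conormal
    sequence of I splits over the neighbourhood {h <> 0} of e.  Translating by
    the generic point and contracting with the antipode replaces h by h(e) = 1:
    the sequence splits globally, which is formal smoothness. *)
Require Import Defs.
From HB Require Import structures.
From mathcomp Require Import all_boot all_order all_algebra.
From mathcomp Require Import boolp ring.

Set Implicit Arguments.
Unset Strict Implicit.
Unset Printing Implicit Defensive.

Import GRing.Theory.
Local Open Scope ring_scope.

(** * Ideals *)

Section Ideals.
Variable R : comNzRingType.
Implicit Types (P Q T : R -> Prop) (B : seq R).

Definition is_ideal Q : Prop :=
  [/\ Q 0, forall x y, Q x -> Q y -> Q (x + y) & forall a x, Q x -> Q (a * x)].

Lemma ideal0 Q : is_ideal Q -> Q 0.
Proof. by case. Qed.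

Lemma idealD Q x y : is_ideal Q -> Q x -> Q y -> Q (x + y).
Proof. by case=> _ + _; apply. Qed.

Lemma idealMl Q a x : is_ideal Q -> Q x -> Q (a * x).
Proof. by case=> _ _; apply. Qed.

Lemma idealMr Q a x : is_ideal Q -> Q x -> Q (x * a).
Proof. by rewrite mulrC; apply: idealMl. Qed.

Lemma idealN Q x : is_ideal Q -> Q x -> Q (- x).
Proof. by rewrite -mulN1r; apply: idealMl. Qed.

Lemma idealB Q x y : is_ideal Q -> Q x -> Q y -> Q (x - y).
Proof. by move=> iQ Qx Qy; apply: idealD => //; apply: idealN. Qed.

Lemma idealB_trans Q y x z : is_ideal Q -> Q (x - y) -> Q (y - z) -> Q (x - z).
Proof. by move=> iQ Qxy Qyz; rewrite -(subrK y x) -addrA; apply: idealD. Qed.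

Lemma ideal_sum Q (I : Type) (r : seq I) (C : pred I) (F : I -> R) :
  is_ideal Q -> (forall i, C i -> Q (F i)) -> Q (\sum_(i <- r | C i) F i).
Proof.
by move=> iQ QF; apply: big_ind => //; [apply: ideal0 | move=> x y; apply: idealD].
Qed.

Lemma gen_is_ideal B : is_ideal (in_gen_ideal B).
Proof.
split; [exact: in_gen_ideal0 | move=> x y Bx By | exact: in_gen_idealM].
rewrite -[y]opprK -[- y]add0r; apply: in_gen_idealB => //.
by apply: in_gen_idealB => //; apply: in_gen_ideal0.
Qed.

Lemma mem_gen B b : b \in B -> in_gen_ideal B b.
Proof.
move=> bB; have lt := bB; rewrite -index_mem in lt.
exists (fun i => (i == Ordinal lt)%:R).
rewrite (bigD1 (Ordinal lt)) //= eqxx mul1r big1 ?addr0 ?nth_index //.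
by move=> i /negPf ->; rewrite mul0r.
Qed.

Lemma gen_least B Q f :
  is_ideal Q -> (forall b, b \in B -> Q b) -> in_gen_ideal B f -> Q f.
Proof.
move=> iQ BQ [c ->]; apply: ideal_sum => // i _.
by apply: idealMl => //; apply/BQ/mem_nth.
Qed.

(** The product is encoded as the intersection of all ideals containing the products. Membership
    then acts as an induction principle: to prove a property, show that it defines an ideal and
    holds on each [a * b]. *)
Definition ideal_mul P Q : R -> Prop := fun f =>
  forall T, is_ideal T -> (forall a b, P a -> Q b -> T (a * b)) -> T f.

Lemma ideal_mul_ideal P Q : is_ideal (ideal_mul P Q).
Proof.
split=> [T iT _|x y x_ y_ T iT PQT|a x x_ T iT PQT].
- exact: ideal0.
- by apply: idealD => //; [apply: x_ | apply: y_].
- by apply: idealMl => //; apply: x_.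
Qed.

Lemma ideal_mul_in P Q a b : P a -> Q b -> ideal_mul P Q (a * b).
Proof. by move=> Pa Qb T _; apply. Qed.

Lemma ideal_mulSl P Q f : is_ideal P -> ideal_mul P Q f -> P f.
Proof. by move=> iP; apply=> // a b Pa _; apply: idealMr. Qed.

Lemma ideal_mulSr P Q f : is_ideal Q -> ideal_mul P Q f -> Q f.
Proof. by move=> iQ; apply=> // a b _ Qb; apply: idealMl. Qed.

Definition ideal_add P Q : R -> Prop := fun f =>
  exists a b, [/\ P a, Q b & f = a + b].

Lemma ideal_add_ideal P Q : is_ideal P -> is_ideal Q -> is_ideal (ideal_add P Q).
Proof.
move=> iP iQ; split=> [|_ _ [a [b [Pa Qb ->]]] [c [e [Pc Qe ->]]]|x _ [a [b [Pa Qb ->]]]].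
- by exists 0, 0; rewrite addr0; split=> //; apply: ideal0.
- by exists (a + c), (b + e); rewrite addrACA; split=> //; apply: idealD.
- by exists (x * a), (x * b); rewrite mulrDr; split=> //; apply: idealMl.
Qed.

Lemma ideal_addl P Q f : is_ideal Q -> P f -> ideal_add P Q f.
Proof. by move=> iQ Pf; exists f, 0; rewrite addr0; split=> //; apply: ideal0. Qed.

Lemma ideal_addr P Q f : is_ideal P -> Q f -> ideal_add P Q f.
Proof. by move=> iP Qf; exists 0, f; rewrite add0r; split=> //; apply: ideal0. Qed.

Fixpoint ideal_pow P (N : nat) : R -> Prop :=
  if N is N'.+1 then ideal_mul P (ideal_pow P N') else fun=> True.

Lemma ideal_pow_ideal P N : is_ideal (ideal_pow P N).
Proof. by case: N => [|N]; [split | apply: ideal_mul_ideal]. Qed.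

Lemma ideal_pow_le P M N f : (M <= N)%N -> ideal_pow P N f -> ideal_pow P M f.
Proof.
elim: N M f => [|N IHN] [|M] f //= leMN Nf.
apply: Nf (ideal_mul_ideal _ _) _ => a b Pa Nb.
by apply: ideal_mul_in => //; apply: IHN.
Qed.

Lemma ideal_powD P M N f g :
  ideal_pow P M f -> ideal_pow P N g -> ideal_pow P (M + N) (f * g).
Proof.
move=> Mf Ng; elim: M f Mf => [|M IHM] f /= Mf.
  by apply: idealMl => //; apply: ideal_pow_ideal.
apply: (Mf (fun h => ideal_mul P (ideal_pow P (M + N)) (h * g))) => [|a b Pa Mb].
  split=> [|x y|c x]; rewrite ?mul0r ?mulrDl -?mulrA;
    have iT := ideal_mul_ideal P (ideal_pow P (M + N)).
  - exact: ideal0.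
  - exact: idealD.
  - exact: idealMl.
by rewrite -mulrA; apply: ideal_mul_in => //; apply: IHM.
Qed.

Lemma ideal_pow1 P f : is_ideal P -> ideal_pow P 1 f <-> P f.
Proof.
move=> iP; split=> [|Pf]; first by apply=> // a b Pa _; apply: idealMr.
by rewrite -[f]mulr1; apply: ideal_mul_in.
Qed.

End Ideals.

Lemma ideal_preim (R S : comNzRingType) (phi : {rmorphism R -> S}) Q :
  is_ideal Q -> is_ideal (Q \o phi).
Proof.
move=> iQ; split=> [|x y Qx Qy|a x Qx] /=; rewrite ?rmorph0 ?rmorphD ?rmorphM.
- exact: ideal0.
- exact: idealD.
- exact: idealMl.
Qed.

Lemma ideal_mul_morph (R S : comNzRingType) (phi : {rmorphism R -> S}) P P' Q Q' f :
    (forall x, P x -> Q (phi x)) -> (forall x, P' x -> Q' (phi x)) ->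
  ideal_mul P P' f -> ideal_mul Q Q' (phi f).
Proof.
move=> PQ PQ' Pf; apply: (Pf (ideal_mul Q Q' \o phi)) => [|a b Pa Pb].
  exact: ideal_preim (ideal_mul_ideal Q Q').
by rewrite /= rmorphM; apply: ideal_mul_in; [exact: PQ | exact: PQ'].
Qed.

Lemma ideal_pow_morph (R S : comNzRingType) (phi : {rmorphism R -> S}) P Q N f :
  (forall x, P x -> Q (phi x)) -> ideal_pow P N f -> ideal_pow Q N (phi f).
Proof.
move=> PQ; elim: N f => [|N IHN] f //= Pf.
apply: (Pf (fun h => ideal_pow Q N.+1 (phi h))) => [|a b Pa Nb].
  exact: (ideal_preim phi (ideal_pow_ideal Q N.+1)).
by rewrite rmorphM; apply: ideal_mul_in; [apply: PQ | apply: IHN].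
Qed.

Lemma mpoly_ind_alg (R : comNzRingType) n (P : {mpoly R[n]} -> Prop) :
    (forall c, P c%:MP) -> (forall i, P 'X_i) ->
    (forall p q, P p -> P q -> P (p + q)) -> (forall p q, P p -> P q -> P (p * q)) ->
  forall p, P p.
Proof.
move=> PC PX PD PM p.
have P1 : P 1 by rewrite -mpolyC1.
rewrite [p]mpolyE; apply: big_ind => [|p' q|m _]; [by rewrite -mpolyC0 | exact: PD | ].
rewrite -mul_mpolyC; apply: (PM) => //; rewrite mpolyXE_id.
apply: big_ind => [//|p' q|i _]; first exact: PM.
elim: {m}(m i) => [|j IHj]; first by rewrite expr0.
by rewrite exprS; apply: PM.
Qed.

(** * Noetherian rings *)

Section Noetherian.

(** The ascending chain condition for sequences of elements. This is the form used below: all terms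
    of a sequence are combinations of the first [K] ones. [fin_gen_ideals] is the form that is
    checked directly. *)
Definition noetherian (R : comNzRingType) : Prop :=
  forall a : nat -> R, exists K, forall m, in_gen_ideal (mkseq a K) (a m).

Definition fin_gen_ideals (R : comNzRingType) : Prop :=
  forall Q : R -> Prop, is_ideal Q ->
  exists2 s : seq R, (forall x, x \in s -> Q x) & forall x, Q x -> in_gen_ideal s x.

Lemma gen_mono (R : comNzRingType) (s t : seq R) f :
  {subset s <= t} -> in_gen_ideal s f -> in_gen_ideal t f.
Proof.
by move=> st; apply: gen_least (gen_is_ideal t) _ => b /st; apply: mem_gen.
Qed.

Lemma mkseq_mono (T : eqType) (a : nat -> T) K L :
  (K <= L)%N -> {subset mkseq a K <= mkseq a L}.
Proof.
move=> leKL x /mapP[i]; rewrite mem_iota => /= ltiK ->.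
by apply: map_f; rewrite mem_iota /= (leq_trans ltiK leKL).
Qed.

Lemma gen_mkseqP (R : comNzRingType) (a : nat -> R) K f :
  in_gen_ideal (mkseq a K) f -> exists c : 'I_K -> R, f = \sum_(i < K) c i * a i.
Proof.
case; rewrite size_mkseq => c ->; exists c.
by apply: eq_bigr => i _; rewrite nth_mkseq.
Qed.

(** The union of the ideals generated by initial segments is an ideal, and its finitely many
    generators already occur in one of them. *)
Lemma fin_gen_noetherian R : fin_gen_ideals R -> noetherian R.
Proof.
move=> fgR a; pose Q x := exists K, in_gen_ideal (mkseq a K) x.
have iQ : is_ideal Q.
  split=> [|x y [K Kx] [L Ly]|b x [K Kx]].
  - by exists 0; apply: in_gen_ideal0.
  - exists (maxn K L); apply: idealD; first exact: gen_is_ideal.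
      by apply: gen_mono Kx; apply: mkseq_mono; rewrite leq_maxl.
    by apply: gen_mono Ly; apply: mkseq_mono; rewrite leq_maxr.
  - by exists K; apply: in_gen_idealM.
have [s sQ Qs] := fgR Q iQ.
have [K sK] : exists K, forall x, x \in s -> in_gen_ideal (mkseq a K) x.
  elim: s sQ {Qs} => [|y s IHs] sQ; first by exists 0.
  have [|K sK] := IHs; first by move=> x xs; apply: sQ; rewrite inE xs orbT.
  have [L yL] := sQ y (mem_head _ _).
  exists (maxn K L) => x; rewrite inE => /predU1P[-> | /sK].
    by apply: gen_mono yL; apply: mkseq_mono; rewrite leq_maxr.
  by apply: gen_mono; apply: mkseq_mono; rewrite leq_maxl.
exists K => m; apply: gen_least (gen_is_ideal _) sK _.
apply: Qs; exists m.+1; apply: mem_gen; apply: map_f.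
by rewrite mem_iota /=.
Qed.

Lemma field_noetherian (k : fieldType) : noetherian k.
Proof.
apply: fin_gen_noetherian => Q iQ.
have [[x Qx nzx] | Q0] := pselect (exists2 x, Q x & x != 0).
  exists [:: x] => [y|y Qy]; first by rewrite inE => /eqP ->.
  rewrite -[y](divfK nzx); apply: in_gen_idealM; apply: mem_gen; exact: mem_head.
exists [::] => // x Qx; have [-> | nzx] := eqVneq x 0; first exact: in_gen_ideal0.
by case: Q0; exists x.
Qed.

Lemma least_nat (T : Type) (P : T -> Prop) (f : T -> nat) :
  (exists x, P x) -> exists2 x, P x & forall y, P y -> (f x <= f y)%N.
Proof.
case=> x; elim/(@ltn_ind): {x}(f x) {-2}x (erefl (f x)) => N IHN x fx Px.
have [[y Py lt] | min] := pselect (exists2 y, P y & (f y < f x)%N).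
  by apply: (IHN (f y) _ y) => //; rewrite -fx.
by exists x => // y Py; rewrite leqNgt; apply/negP => lt; apply: min; exists y.
Qed.

(** Euclidean division by a nonzero element of least absolute value. *)
Lemma int_noetherian : noetherian int.
Proof.
apply: fin_gen_noetherian => Q iQ.
have [Qnz | Q0] := pselect (exists x, Q x /\ x != 0).
  have [x [Qx nzx] minx] := least_nat (fun z : int => `|z|%N) Qnz.
  exists [:: x] => [y|y Qy]; first by rewrite inE => /eqP ->.
  have Qr : Q (y %% x)%Z.
    rewrite /modz; apply: idealB => //; exact: idealMl.
  have [r0 | nzr] := eqVneq (y %% x)%Z 0.
    rewrite (divz_eq y x) r0 addr0; apply: in_gen_idealM; apply: mem_gen; exact: mem_head.
  have := minx _ (conj Qr nzr).
  by rewrite leqNgt -ltz_nat gez0_abs ?modz_ge0 // abszE ltz_mod.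
exists [::] => // x Qx; have [-> | nzx] := eqVneq x 0; first exact: in_gen_ideal0.
by case: Q0; exists x.
Qed.

Lemma noetherian_image (R S : comNzRingType) (phi : {rmorphism R -> S}) :
  (forall y, exists x, phi x = y) -> noetherian R -> noetherian S.
Proof.
move=> /choice[psi psiK] nR a; have [K aK] := nR (psi \o a).
exists K => m; rewrite -(psiK (a m)).
apply: (gen_least (ideal_preim phi (gen_is_ideal _))) (aK m) => b /mapP[i iK ->] /=.
by rewrite psiK; apply: mem_gen; apply: map_f.
Qed.

(* Hilbert's basis theorem: otherwise successively chosen elements of minimal
   degree outside the ideal generated by the previous ones have leading
   coefficients that contradict [noetherian R]. *)
Lemma poly_noetherian (R : comNzRingType) : noetherian R -> noetherian {poly R}.
Proof.
move=> nR; apply: fin_gen_noetherian => Q iQ; apply: contrapT => nfg.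
have next (s : seq {poly R}) : exists h : {poly R}, (forall x, x \in s -> Q x) ->
    [/\ Q h, ~ in_gen_ideal s h &
        forall g, Q g -> ~ in_gen_ideal s g -> (size h <= size g)%N].
  have [sQ | nsQ] := pselect (forall x, x \in s -> Q x); last by exists 0.
  have [|h [Qh nh] minh] := @least_nat _ (fun h => Q h /\ ~ in_gen_ideal s h) (fun h => size h).
    apply: contrapT => none; apply: nfg; exists s => // x Qx.
    by apply: contrapT => nx; apply: none; exists x.
  by exists h => _; split=> // g Qg ng; apply: minh.
have [h hP] : exists h : nat -> {poly R}, forall K,
    [/\ Q (h K), ~ in_gen_ideal (mkseq h K) (h K) &
        forall g, Q g -> ~ in_gen_ideal (mkseq h K) g -> (size (h K) <= size g)%N].
  have [F FP] := choice next.
  pose L := fix L K := if K is K'.+1 then rcons (L K') (F (L K')) else [::].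
  have LE K : L K = mkseq (F \o L) K by elim: K => //= K IHK; rewrite mkseqS -IHK.
  exists (F \o L) => K; rewrite -LE; apply: (FP).
  elim: K => [|K IHK] x //=; rewrite mem_rcons inE => /predU1P[-> | /IHK //].
  by have [] := FP _ IHK.
have hQ K x : x \in mkseq h K -> Q x.
  by case/mapP => i _ ->; have [] := hP i.
have hmono i K : (i <= K)%N -> (size (h i) <= size (h K))%N.
  move=> leiK; have [_ _ min] := hP i; have [QK nK _] := hP K; apply: min => // in_i.
  by apply: nK; apply: gen_mono in_i; apply: mkseq_mono.
have [K leadK] := nR (fun i => lead_coef (h i)).
have [QK nK minK] := hP K; have [c cE] := gen_mkseqP (leadK K).
have szK : (0 < size (h K))%N.
  by rewrite lt0n size_poly_eq0; apply/eqP => h0; apply: nK; rewrite h0; apply: in_gen_ideal0.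
(* By [cE], [g] has the same top coefficient as [h K]. Hence [h K - g] is shorter, while it stays
   outside the ideal of the previous elements, against the minimality of [h K]. *)
pose g := \sum_(i < K) (c i *: 'X^(size (h K) - size (h i))) * h i.
have gL : in_gen_ideal (mkseq h K) g.
  apply: ideal_sum; first exact: gen_is_ideal.
  move=> i _; apply: in_gen_idealM; apply: mem_gen.
  by apply: map_f; rewrite mem_iota /=.
have Qg : Q g by apply: gen_least gL => //; exact: hQ.
suff: (size (h K - g)%R < size (h K))%N.
  rewrite ltnNge minK //; first exact: idealB.
  move=> hgL; apply: nK; rewrite -[h K](subrK g); apply: idealD => //.
  exact: gen_is_ideal.
rewrite -(ltn_predK szK) ltnS; apply/leq_sizeP => j; rewrite leq_eqVlt => /predU1P[<- | ltj].
  rewrite coefB -/(lead_coef _) cE coef_sum; apply/eqP; rewrite subr_eq0; apply/eqP.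
  apply: eq_bigr => i _ /=; rewrite -scalerAl coefZ coefXnM.
  congr (_ * _); have lei : (size (h i) <= size (h K))%N by apply: hmono; rewrite ltnW.
  have [szi0|szi] := posnP (size (h i)).
    move/eqP: szi0; rewrite size_poly_eq0 => /eqP ->.
    by rewrite lead_coef0 coef0 if_same.
  rewrite ltnNge -subn1 leq_sub2l //= lead_coefE; congr (_`_ _).
  by rewrite subnAC subKn ?subn1.
rewrite prednK // in ltj.
rewrite coefB coef_sum [(h K)`_j]nth_default // big1 ?subr0 // => i _.
rewrite -scalerAl coefZ coefXnM ltnNge (leq_trans (leq_subr _ _)) //=.
rewrite nth_default ?mulr0 // leq_subRL ?subnK //.
  by apply: hmono; rewrite ltnW.
exact: leq_trans (leq_subr _ _) ltj.
Qed.

(** Induction on [n]: sending the variable of [{poly {mpoly R[n]}}] to the last variable is a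
    surjection onto [{mpoly R[n.+1]}]. *)
Lemma mpoly_noetherian (R : comNzRingType) n : noetherian R -> noetherian {mpoly R[n]}.
Proof.
move=> nR; elim: n => [|n IHn].
  apply: (noetherian_image (phi := @mpolyC 0 R)) nR => p.
  exists p@_0; apply/mpolyP => m; rewrite mcoeffC.
  have -> : m = 0%MM by apply/mnmP => -[].
  by rewrite eqxx mulr1.
pose phi : {rmorphism _ -> _} :=
  horner_eval ('X_ord_max : {mpoly R[n.+1]}) \o map_poly (@mwiden n R).
apply: (noetherian_image (phi := phi)); last exact: poly_noetherian.
apply: mpoly_ind_alg => [c|i|p q [x <-] [y <-]|p q [x <-] [y <-]].
- by exists c%:MP%:P; rewrite /phi /= map_polyC /= /horner_eval hornerC mwidenC.
- have [j ->|->] := unliftP ord_max i.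
    exists ('X_j)%:P; rewrite /phi /= map_polyC /= /horner_eval hornerC mwidenX mnmwiden1.
    by congr 'X_[U_(_)]; apply: val_inj; rewrite /= /bump leqNgt ltn_ord.
  by exists 'X; rewrite /phi /= map_polyX /horner_eval hornerX.
- by exists (x + y); rewrite rmorphD.
- by exists (x * y); rewrite rmorphM.
Qed.

End Noetherian.

(** * Morphisms from polynomial rings *)

Lemma mderivXU (R : nzRingType) n (i j : 'I_n) :
  ('X_i)^`M(j) = (i == j)%:R :> {mpoly R[n]}.
Proof.
rewrite mderivX mnm1E; case: eqP => [->|_]; last by rewrite scale0r.
by rewrite scale1r -{1}[U_(j)%MM]add0m addmK mpolyX0.
Qed.

Section Morphisms.
Variables (R C : comNzRingType) (n : nat).
Implicit Types (f : {mpoly R[n]}) (Q : C -> Prop).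

(** Congruence modulo an ideal is compatible with sums and products. The zero ideal gives uniqueness
    of morphisms; other ideals give congruences between substitutions. *)
Lemma mpoly_morph_mod (phi psi : {rmorphism {mpoly R[n]} -> C}) Q :
    is_ideal Q -> (forall c, Q (phi c%:MP - psi c%:MP)) ->
    (forall i, Q (phi 'X_i - psi 'X_i)) ->
  forall f, Q (phi f - psi f).
Proof.
move=> iQ QC QX; apply: mpoly_ind_alg => // p q Qp Qq.
  by rewrite !rmorphD opprD addrACA; apply: idealD.
rewrite !rmorphM.
have -> : phi p * phi q - psi p * psi q =
  phi p * (phi q - psi q) + psi q * (phi p - psi p) by ring.
by apply: idealD => //; apply: idealMl.
Qed.

Lemma mpoly_morph_ext (phi psi : {rmorphism {mpoly R[n]} -> C}) :
    (forall c, phi c%:MP = psi c%:MP) -> (forall i, phi 'X_i = psi 'X_i) ->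
  phi =1 psi.
Proof.
move=> eqC eqX f; apply/eqP; rewrite -subr_eq0; apply/eqP.
apply: (@mpoly_morph_mod phi psi (fun x => x = 0)) => [|c|i].
- by split=> [//|x y -> ->|a x ->]; rewrite ?addr0 ?mulr0.
- by rewrite eqC subrr.
- by rewrite eqX subrr.
Qed.

(** First-order expansion, valid in every characteristic: in a product, the two linear terms
    multiply into [Q]. It serves for Newton's method, for the translation argument and for
    infinitesimal lifting. *)
Lemma mpoly_taylor (phi : {rmorphism R -> C}) (x dx : 'I_n -> C) Q :
    is_ideal Q -> (forall i j, Q (dx i * dx j)) ->
  forall f, Q (mmap phi (fun i => x i + dx i) f - mmap phi x f
               - \sum_i mmap phi x f^`M(i) * dx i).
Proof.
move=> iQ Qdx; apply: mpoly_ind_alg => [c|i|p q Qp Qq|p q Qp Qq].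
- rewrite !mmapC subrr sub0r big1 ?oppr0; first exact: ideal0.
  by move=> i _; rewrite mderivC mmap0 mul0r.
- rewrite !mmapX !mmap1U [x i + _]addrC addrK (bigD1 i) //= mderivXU eqxx.
  rewrite rmorph1 mul1r big1 ?addr0 ?subrr; first exact: ideal0.
  by move=> j /negPf ji; rewrite mderivXU eq_sym ji rmorph0 mul0r.
- under eq_bigr => i _ do rewrite mderivD mmapD mulrDl.
  rewrite big_split /= !mmapD; set s := \sum_i _ in Qp *; set t := \sum_i _ in Qq *.
  by apply: eq_ind (idealD iQ Qp Qq) _ _; ring.
- have -> : \sum_i mmap phi x (p * q)^`M(i) * dx i
      = (\sum_i mmap phi x p^`M(i) * dx i) * mmap phi x q
        + mmap phi x p * \sum_i mmap phi x q^`M(i) * dx i.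
    rewrite mulr_sumr mulr_suml -big_split /=; apply: eq_bigr => i _.
    by rewrite mderivM rmorphD !rmorphM /=; ring.
  rewrite !rmorphM /=.
  set p0 := mmap phi x p in Qp *; set q0 := mmap phi x q in Qq *.
  set p1 := mmap _ _ p in Qp *; set q1 := mmap _ _ q in Qq *.
  have : Q ((\sum_i mmap phi x p^`M(i) * dx i) * \sum_i mmap phi x q^`M(i) * dx i).
    rewrite mulr_suml; apply: ideal_sum => // i _; rewrite mulr_sumr.
    by apply: ideal_sum => // j _; rewrite mulrACA; apply: idealMl.
  set s := \sum_i _ in Qp *; set t := \sum_i _ in Qq *.
  move=> Qst; have -> : p1 * q1 - p0 * q0 - (s * q0 + p0 * t) =
    q1 * (p1 - p0 - s) + (p0 + s) * (q1 - q0 - t) + s * t by ring.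
  by apply: idealD => //; apply: idealD => //; apply: idealMl.
Qed.

(** Chain rule: a derivation with values in [C], seen as a module through [phi], is determined by
    its values on the variables. *)
Lemma derivation_along (phi : {rmorphism {mpoly R[n]} -> C}) (D : {mpoly R[n]} -> C) :
    (forall c, D c%:MP = 0) -> (forall p q, D (p + q) = D p + D q) ->
    (forall p q, D (p * q) = D p * phi q + phi p * D q) ->
  forall f, D f = \sum_i phi f^`M(i) * D 'X_i.
Proof.
move=> DC DD DM; apply: mpoly_ind_alg => [c|i|p q IHp IHq|p q IHp IHq].
- by rewrite DC big1 // => i _; rewrite mderivC rmorph0 mul0r.
- rewrite (bigD1 i) //= mderivXU eqxx rmorph1 mul1r.
  rewrite big1 ?addr0 // => j /negPf ji.
  by rewrite mderivXU eq_sym ji rmorph0 mul0r.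
- rewrite DD IHp IHq -big_split; apply: eq_bigr => i _ /=.
  by rewrite mderivD rmorphD mulrDl.
- rewrite DM IHp IHq mulr_suml mulr_sumr -big_split; apply: eq_bigr => i _ /=.
  by rewrite mderivM rmorphD !rmorphM /=; ring.
Qed.

End Morphisms.

(** * Powers of the maximal ideal of a point *)

Section PointIdeal.
Variables (R : comNzRingType) (n : nat).
Local Notation S := {mpoly R[n]}.
Implicit Types (e : 'I_n -> R) (f : S).

Definition vanish e f : Prop := f.@[e] = 0.

Lemma vanish_ideal e : is_ideal (vanish e).
Proof.
rewrite /vanish; split=> [|f g f0 g0|a f f0]; rewrite ?meval0 ?mevalD ?mevalM //.
  by rewrite f0 g0 addr0.
by rewrite f0 mulr0.
Qed.

Lemma subst_const m (e : 'I_n -> R) f :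
  mmap (@mpolyC m R) (fun i => (e i)%:MP) f = (f.@[e])%:MP.
Proof.
apply: (mpoly_morph_ext (phi := mmap (@mpolyC m R) (fun i => (e i)%:MP))
         (psi := @mpolyC m R \o meval e)) => [c|i] /=.
  by rewrite mmapC mevalC.
by rewrite mmapX mmap1U mevalXU.
Qed.

Lemma subst_id f : mmap (@mpolyC n R) (fun i => 'X_i) f = f.
Proof.
apply: (mpoly_morph_ext (phi := mmap (@mpolyC n R) (fun i => 'X_i)) (psi := idfun)) => [c|i] /=.
  by rewrite mmapC.
by rewrite mmapX mmap1U.
Qed.

Lemma vanishX e i : vanish e ('X_i - (e i)%:MP).
Proof. by rewrite /vanish mevalB mevalXU mevalC subrr. Qed.

Lemma vanishB e f : vanish e (f - (f.@[e])%:MP).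
Proof. by rewrite /vanish mevalB mevalC subrr. Qed.

Lemma vanish_gen e f : vanish e f ->
  exists c : 'I_n -> S, f = \sum_i c i * ('X_i - (e i)%:MP).
Proof.
move=> f0; pose Q g := exists c : 'I_n -> S, g = \sum_i c i * ('X_i - (e i)%:MP).
suff : Q (f - (f.@[e])%:MP) by rewrite f0 mpolyC0 subr0.
apply: (mpoly_morph_mod (phi := idfun) (psi := @mpolyC n R \o meval e) (Q := Q)) => [|c|i] /=.
- split=> [|_ _ [c ->] [c' ->]|a _ [c ->]].
  + by exists (fun=> 0); rewrite big1 // => i _; rewrite mul0r.
  + exists (fun i => c i + c' i); rewrite -big_split; apply: eq_bigr => i _ /=.
    by rewrite mulrDl.
  + exists (fun i => a * c i); rewrite mulr_sumr; apply: eq_bigr => i _.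
    by rewrite mulrA.
- exists (fun=> 0); rewrite mevalC subrr big1 // => i _; exact: mul0r.
- exists (fun j => (i == j)%:R); rewrite mevalXU (bigD1 i) //= eqxx mul1r big1 ?addr0 //.
  by move=> j /negPf ji; rewrite eq_sym ji mul0r.
Qed.

Local Notation mpow e := (ideal_pow (vanish e)).

(** Leibniz rule on a product of N + 1 factors vanishing at [e]: each term keeps N of them. *)
Lemma mpow_deriv e N f i : mpow e N.+1 f -> mpow e N f^`M(i).
Proof.
elim: N f => [//|N IHN] f fN.
have iN := ideal_pow_ideal (vanish e).
(* Membership of [f] itself is carried along, since differentiating a multiple [a * x] also produces
   a multiple of [x]. *)
suff [] : mpow e N.+2 f /\ mpow e N.+1 f^`M(i) by [].
apply: (fN (fun f => mpow e N.+2 f /\ mpow e N.+1 f^`M(i))) => [|a b a0 bN].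
  split=> [|x y [x1 x2] [y1 y2]|a x [x1 x2]]; split.
  - exact: (ideal0 (iN _)).
  - by rewrite linear0; exact: (ideal0 (iN _)).
  - exact: (idealD (iN _)).
  - by rewrite mderivD; exact: (idealD (iN _)).
  - exact: (idealMl _ (iN _)).
  - rewrite mderivM; apply: (idealD (iN _)) => //; apply: (idealMl _ (iN _)) => //.
    exact: ideal_pow_le x1.
split; first exact: ideal_mul_in.
rewrite mderivM; apply: (idealD (iN _)); first exact: (idealMl _ (iN _)).
by apply: ideal_mul_in => //; apply: IHN.
Qed.

Lemma vanish_taylor e f : vanish e f ->
  mpow e 2 (f - \sum_i (f^`M(i).@[e])%:MP * ('X_i - (e i)%:MP)).
Proof.
move=> f0; have := @mpoly_taylor R S n (@mpolyC n R) (fun i => (e i)%:MP)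
  (fun i => 'X_i - (e i)%:MP) _ (ideal_pow_ideal (vanish e) 2) _ f.
rewrite (_ : (fun i => _) = (fun i => 'X_i)); last first.
  by apply/funext => i; rewrite addrC subrK.
rewrite subst_id subst_const f0 mpolyC0 subr0.
under eq_bigr => i _ do rewrite subst_const.
apply=> i j; apply: ideal_mul_in; first exact: vanishX.
by apply/ideal_pow1; [exact: vanish_ideal | exact: vanishX].
Qed.

(** The Euler operator [E] is a derivation, and [E a - a] has order 2 when [a] vanishes at [e], by
    the first-order expansion of [a]. The general case follows by writing E(ab) - (N+1)ab as (E a -
    a) b + a (E b - N b). *)
Lemma mpow_euler e N f : mpow e N f ->
  mpow e N.+1 (\sum_i ('X_i - (e i)%:MP) * f^`M(i) - f *+ N).
Proof.
pose E (f : S) := \sum_i ('X_i - (e i)%:MP) * f^`M(i).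
have ED x y : E (x + y) = E x + E y.
  by rewrite -big_split; apply: eq_bigr => i _ /=; rewrite mderivD mulrDr.
have EM x y : E (x * y) = E x * y + x * E y.
  rewrite mulr_suml mulr_sumr -big_split; apply: eq_bigr => i _ /=.
  by rewrite mderivM; ring.
have iN M := ideal_pow_ideal (vanish e) M.
have E1 x : mpow e 1 (E x).
  by apply: ideal_sum => // i _; apply: ideal_mul_in => //; exact: vanishX.
rewrite -/(E f); elim: N f => [|N IHN] f fN; first by rewrite subr0.
suff [] : mpow e N.+1 f /\ mpow e N.+2 (E f - f *+ N.+1) by [].
apply: (fN (fun f => mpow e N.+1 f /\ mpow e N.+2 (E f - f *+ N.+1))) => [|a b a0 bN].
  split=> [|x y [x1 x2] [y1 y2]|a x [x1 x2]]; split.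
  - exact: (ideal0 (iN _)).
  - have -> : E 0 = 0 by rewrite /E big1 // => i _; rewrite linear0 mulr0.
    by rewrite mul0rn subr0; exact: (ideal0 (iN _)).
  - exact: (idealD (iN _)).
  - by rewrite ED mulrnDl opprD addrACA; exact: (idealD (iN _)).
  - exact: (idealMl _ (iN _)).
  - rewrite EM -addrA -mulrnAr -mulrBr.
    apply: (idealD (iN _)) => //; last exact: (idealMl _ (iN _)).
    exact: (@ideal_powD _ _ 1).
split; first exact: ideal_mul_in.
have -> : E (a * b) - (a * b) *+ N.+1 = (E a - a) * b + a * (E b - b *+ N).
  by rewrite EM mulrSr -mulrnAr; ring.
apply: (idealD (iN _)) => //; last by apply: ideal_mul_in => //; apply: IHN.
apply: (@ideal_powD _ _ 2) => //.
have -> : E a - a = \sum_i ('X_i - (e i)%:MP) * (a^`M(i) - (a^`M(i).@[e])%:MP)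
    - (a - \sum_i (a^`M(i).@[e])%:MP * ('X_i - (e i)%:MP)).
  rewrite opprB addrA -big_split; congr (_ - _); apply: eq_bigr => i _ /=; ring.
apply: (idealB (iN _)) => //; last exact: vanish_taylor.
apply: ideal_sum => // i _; apply: ideal_mul_in; first exact: vanishX.
by apply/ideal_pow1; [exact: vanish_ideal | exact: vanishB].
Qed.

(** Together with [mpow_shift], this turns the order of vanishing at a point into equations on
    coefficients. *)
Lemma mpow0P N f : mpow (fun=> 0) N f <-> forall m, (mdeg m < N)%N -> f@_m = 0.
Proof.
split=> [|f0].
  elim: N f => [//|N IHN] f fN; apply: (fN (fun f => forall m, (mdeg m < N.+1)%N -> f@_m = 0)).
    split=> [m _|x y x0 y0 m ltm|a x x0 m ltm]; first exact: mcoeff0.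
      by rewrite mcoeffD x0 // y0 // addr0.
    rewrite mcoeffM big1 // => /= -[m1 m2] /eqP /=;
      move: (bmnm m1) (bmnm m2) => {}m1 {}m2 mE.
    rewrite x0 ?mulr0 //; apply: leq_ltn_trans ltm.
    by rewrite mE mdegD leq_addl.
  move=> a b a0 bN m ltm; rewrite mcoeffM big1 // => /= -[m1 m2] /eqP /=;
      move: (bmnm m1) (bmnm m2) => {}m1 {}m2 mE.
  have [m10|nz] := eqVneq (m1 : 'X_{1..n}) 0%MM.
    rewrite m10; suff -> : a@_0 = 0 by rewrite mul0r.
    rewrite -[RHS]a0.
    apply: (mpoly_morph_ext (phi := mcoeff 0) (psi := meval (fun=> 0))) => [c|i] /=.
      by rewrite mcoeffC eqxx mulr1 mevalC.
    by rewrite mevalXU mcoeffX -mdeg_eq0 mdeg1.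
  rewrite (IHN b bN) ?mulr0 // -ltnS; apply: leq_trans ltm.
  rewrite mE mdegD ltnS -{1}[mdeg m2]add0n ltn_add2r lt0n mdeg_eq0 //.
have iN := ideal_pow_ideal (vanish (fun=> 0)).
rewrite [f]mpolyE; apply: ideal_sum => [|m _]; first exact: iN.
have [/f0 ->|leN] := ltnP (mdeg m) N; first by rewrite scale0r; exact: (ideal0 (iN _)).
rewrite -mul_mpolyC; apply: (idealMl _ (iN _)) => //; apply: ideal_pow_le leN _.
rewrite mpolyXE_id mdegE; elim/big_rec2: _ => // i N' g _ gN'.
apply: ideal_powD => //; elim: (m i) => // j IHj.
rewrite exprS; apply: ideal_mul_in => //.
by rewrite /vanish mevalXU.
Qed.

End PointIdeal.

(** * Newton iteration and a uniform order bound *)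

Section Substitution.
Variables (R : comNzRingType) (n : nat).
Local Notation S := {mpoly R[n]}.
Implicit Types (e : 'I_n -> R) (f : S) (xi : 'I_n -> S).
Local Notation subst := (mmap (@mpolyC n R)).

Lemma subst_meval m (xi : 'I_n -> {mpoly R[m]}) (e' : 'I_m -> R) f :
  (mmap (@mpolyC m R) xi f).@[e'] = f.@[fun i => (xi i).@[e']].
Proof.
apply: (mpoly_morph_ext (phi := meval e' \o mmap (@mpolyC m R) xi)
         (psi := meval (fun i => (xi i).@[e']))) => [c|i] /=.
  by rewrite mmapC !mevalC.
by rewrite mmapX mmap1U mevalXU.
Qed.

Lemma subst_subst m l (xi1 : 'I_m -> {mpoly R[l]}) (xi2 : 'I_n -> {mpoly R[m]}) f :
  mmap (@mpolyC l R) xi1 (mmap (@mpolyC m R) xi2 f) =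
  mmap (@mpolyC l R) (fun i => mmap (@mpolyC l R) xi1 (xi2 i)) f.
Proof.
apply: (mpoly_morph_ext
  (phi := mmap (@mpolyC l R) xi1 \o mmap (@mpolyC m R) xi2)
  (psi := mmap (@mpolyC l R) (fun i => mmap (@mpolyC l R) xi1 (xi2 i)))) => [c|i] /=.
  by rewrite !mmapC.
by rewrite !mmapX !mmap1U.
Qed.

Lemma subst_mod m (Q : {mpoly R[m]} -> Prop) (xi1 xi2 : 'I_n -> {mpoly R[m]}) f :
  is_ideal Q -> (forall i, Q (xi1 i - xi2 i)) ->
  Q (mmap (@mpolyC m R) xi1 f - mmap (@mpolyC m R) xi2 f).
Proof.
move=> iQ Qxi; apply: (mpoly_morph_mod (phi := mmap (@mpolyC m R) xi1)
  (psi := mmap (@mpolyC m R) xi2) iQ) => [c|i] /=.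
  by rewrite !mmapC subrr; exact: ideal0.
by rewrite !mmapX !mmap1U.
Qed.

Definition shift e : 'I_n -> S := fun i => 'X_i + (e i)%:MP.

Lemma mpow_shift e N f :
  ideal_pow (vanish e) N f <-> ideal_pow (vanish (fun=> 0)) N (subst (shift e) f).
Proof.
have sh e1 e2 g : vanish e1 (subst (shift e2) g) <-> vanish (fun i => e1 i + e2 i) g.
  rewrite /vanish subst_meval (_ : (fun i => _) = (fun i => e1 i + e2 i)) //.
  by apply/funext => i; rewrite mevalD mevalXU mevalC.
split=> fN.
  apply: (ideal_pow_morph (phi := subst (shift e))) fN => g g0; apply/sh.
  by rewrite (_ : (fun i => _) = e) //; apply/funext => i; rewrite add0r.
have -> : f = subst (shift (fun i => - e i)) (subst (shift e) f).
  rewrite subst_subst -[LHS]subst_id; congr (subst _ f); apply/funext => i.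
  by rewrite mmapD mmapX mmap1U mmapC /shift mpolyCN subrK.
apply: (ideal_pow_morph (phi := subst _)) fN => g g0; apply/sh.
by rewrite (_ : (fun i => _) = (fun=> 0)) //; apply/funext => i; rewrite subrr.
Qed.

(** Newton's iteration with the identity in place of the inverse Jacobian matrix. This is adequate
    when the Jacobian matrix of [g] at the point is a projection fixing [g], as assumed in the next
    section. *)
Fixpoint newton (g : 'I_n -> S) N : 'I_n -> S :=
  if N is N'.+1 then fun i => newton g N' i - subst (newton g N') (g i)
  else fun i => 'X_i.

End Substitution.

Section Newton.
Variables (R : comNzRingType) (n : nat).
Local Notation S := {mpoly R[n]}.
Local Notation subst := (mmap (@mpolyC n R)).
Variables (e : 'I_n -> R) (g : 'I_n -> S) (P : 'I_n -> 'I_n -> R).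
Hypothesis g0 : forall i, vanish e (g i).
Hypothesis gP : forall i, g i = \sum_j (P i j)%:MP * g j.
Hypothesis dgP : forall i j, (g i)^`M(j).@[e] = P i j.
Local Notation mpow := (ideal_pow (vanish e)).
Local Notation J := (in_gen_ideal (codom g)).

Lemma newton_pt N i : (newton g N i).@[e] = e i.
Proof.
elim: N i => [|N IHN] i /=; first by rewrite mevalXU.
rewrite mevalB IHN subst_meval (_ : (fun i => _) = e); last exact/funext.
by rewrite g0 subr0.
Qed.

(** Each correction is [g i] taken at the previous iterate, which is congruent to [g i] itself
    modulo [J]. *)
Lemma newton_mod N f : J (subst (newton g N) f - f).
Proof.
have iJ := gen_is_ideal (codom g).
rewrite -{2}[f]subst_id; apply: subst_mod => //.
elim: N => [|N IHN] i /=; first by rewrite subrr; exact: ideal0.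
rewrite addrAC; apply: (idealB iJ) => //.
rewrite -[mmap _ _ _](subrK (g i)); apply: (idealD iJ).
  by rewrite -{2}[g i]subst_id; apply: subst_mod.
by apply: mem_gen; apply: codom_f.
Qed.

(** With xi the iterate, g_i(xi - g(xi)) equals g_i(xi) - sum_j (d_j g_i)(xi) g_j(xi) up to order
    2(N+1). By [gP] this is the sum of the (P_ij - (d_j g_i)(xi)) g_j(xi), whose first factors
    vanish at [e] by [dgP]: one order is gained. *)
Lemma newton_order N i : mpow N.+1 (subst (newton g N) (g i)).
Proof.
have iM N' := ideal_pow_ideal (vanish e) N'.
elim: N i => [|N IHN] i.
  by apply/ideal_pow1; [exact: vanish_ideal | rewrite /= subst_id; exact: g0].
have := @mpoly_taylor R S n (@mpolyC n R) (newton g N)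
  (fun i => - subst (newton g N) (g i)) _ (iM N.+2) _ (g i).
set xi := newton g N; set s := \sum_j _ => taylor.
have sE : subst xi (g i) + s = \sum_j ((P i j)%:MP - subst xi (g i)^`M(j)) * subst xi (g j).
  rewrite {1}gP rmorph_sum -big_split; apply: eq_bigr => j _ /=.
  by rewrite rmorphM /= mmapC mulrN mulrBl.
rewrite -[X in mpow _ X](subrK (subst xi (g i) + s)) opprD [_ + (- _ - _)]addrA.
apply: (idealD (iM N.+2)).
  apply: taylor => j j'; rewrite mulrNN; apply: (@ideal_pow_le _ _ _ (N.+1 + N.+1)).
    by rewrite addSn ltnS leq_addl.
  exact: ideal_powD.
rewrite sE; apply: ideal_sum => [|j _]; first exact: iM.
apply: ideal_mul_in; last exact: IHN.
rewrite /vanish mevalB mevalC subst_meval (_ : (fun i => _) = e).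
  by rewrite dgP subrr.
by apply/funext => j'; exact: newton_pt.
Qed.

(** Substituting the iterate is the identity modulo [J], sends [J] into the N-th power and preserves
    that power. Membership thus becomes a condition on one explicit polynomial. *)
Lemma newton_mem N b : ideal_add J (mpow N) b <-> mpow N (subst (newton g N) b).
Proof.
have iM := ideal_pow_ideal (vanish e) N.
split=> [[x [y [Jx My ->]]] | bN]; last first.
  exists (b - subst (newton g N) b), (subst (newton g N) b); rewrite subrK; split=> //.
  by rewrite -opprB; apply: idealN; [exact: gen_is_ideal | exact: newton_mod].
rewrite mmapD; apply: (idealD iM).
  apply: (gen_least (Q := mpow N \o subst (newton g N))) Jx; first exact: ideal_preim.
  move=> _ /codomP[i ->]; apply: (@ideal_pow_le _ _ _ N.+1) => //; exact: newton_order.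
apply: (ideal_pow_morph (phi := subst (newton g N))) My => f f0.
by rewrite /vanish subst_meval (_ : (fun i => _) = e) //; apply/funext => i; exact: newton_pt.
Qed.

End Newton.

Lemma map_mpoly_subst (R C : comNzRingType) (phi : {rmorphism R -> C}) n m
    (xi : 'I_n -> {mpoly R[m]}) f :
  map_mpoly phi (mmap (@mpolyC m R) xi f) =
  mmap (@mpolyC m C) (fun i => map_mpoly phi (xi i)) (map_mpoly phi f).
Proof.
apply: (mpoly_morph_ext (phi := map_mpoly phi \o mmap (@mpolyC m R) xi)
  (psi := mmap (@mpolyC m C) (fun i => map_mpoly phi (xi i)) \o map_mpoly phi)) => [c|i] /=.
  by rewrite mmapC !map_mpolyC mmapC.
by rewrite map_mpolyX !mmapX !mmap1U.
Qed.

Lemma map_newton (R C : comNzRingType) (phi : {rmorphism R -> C}) n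
    (g : 'I_n -> {mpoly R[n]}) N i :
  map_mpoly phi (newton g N i) = newton (fun i => map_mpoly phi (g i)) N i.
Proof.
elim: N i => [|N IHN] i /=; first by rewrite map_mpolyX.
have -> : newton (fun i => map_mpoly phi (g i)) N = (fun i => map_mpoly phi (newton g N i)).
  by apply/funext => j; rewrite IHN.
by rewrite rmorphB /= map_mpoly_subst.
Qed.

(* The coefficients of [b] at the Newton iterates are polynomials with integer
   coefficients in those of [g], [b] and [e]; finitely many of these generate
   the ideal of all of them. *)
Lemma uniform_order n d : exists N0, forall (k : fieldType) (e : 'I_n -> k)
    (g : 'I_n -> {mpoly k[n]}) (P : 'I_n -> 'I_n -> k) (b : {mpoly k[n]}),
    (forall i, msize (g i) <= d.+1)%N -> (msize b <= d.+1)%N ->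
    (forall i, vanish e (g i)) -> (forall i, g i = \sum_j (P i j)%:MP * g j) ->
    (forall i j, (g i)^`M(j).@[e] = P i j) ->
    ideal_add (in_gen_ideal (codom g)) (ideal_pow (vanish e) N0) b ->
  forall N, ideal_add (in_gen_ideal (codom g)) (ideal_pow (vanish e) N) b.
Proof.
(* One indeterminate for each coefficient of each [g i] (index [Some i]), for each coefficient of
   [b] (index [None]), and for each coordinate of [e]. *)
pose V := (option 'I_n * 'X_{1..n < d.+1} + 'I_n)%type.
pose U := {mpoly int[#|{: V}|]}.
pose x (v : V) : U := 'X_(enum_rank v).
pose G (i : option 'I_n) : {mpoly U[n]} :=
  \sum_(m : 'X_{1..n < d.+1}) x (inl (i, m)) *: 'X_[m].
pose E j := x (inr j).
pose F N := mmap (@mpolyC n U) (shift E)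
  (mmap (@mpolyC n U) (newton (fun i => G (Some i)) N) (G None)).
(* A single sequence listing the coefficients of degree less than N of all the [F N]; all other
   indices give 0. *)
pose a t : U := if unpickle t is Some (N, m) then
   if (mdeg (m : 'X_{1..n}) < N)%N then (F N)@_m else 0 else 0.
have nU : noetherian U by apply: mpoly_noetherian; exact: int_noetherian.
have [K aK] := nU a.
(* The largest N met among the [K] generating terms. The [let] only fixes the type at which
   [unpickle] decodes. *)
pose N0 := \max_(t < K) (if unpickle t is Some (N, m) then
  let _ : 'X_{1..n} := m in N else 0%N).
exists N0 => k e g P b szg szb g0 gP dgP bN0 N.
pose c (v : V) : k := match v with
  | inl (i, m) => (if i is Some i then g i else b)@_m | inr j => e j end.
pose phi : {rmorphism U -> k} := mmap (intr : int -> k) (fun t => c (enum_val t)).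
have phix v : phi (x v) = c v by rewrite /phi /x /= mmapX mmap1U enum_rankK.
have phiG i : map_mpoly phi (G i) = if i is Some i then g i else b.
  have -> : (if i is Some i then g i else b) =
     \sum_(m : 'X_{1..n < d.+1}) c (inl (i, m)) *: 'X_[m].
    by rewrite /c -mpolywE //; case: (i).
  rewrite /G rmorph_sum; apply: eq_bigr => m _ /=.
  by rewrite map_mpolyZ map_mpolyX phix.
have phiF M : map_mpoly phi (F M) =
    mmap (@mpolyC n k) (shift e) (mmap (@mpolyC n k) (newton g M) b).
  have -> : shift e = (fun i => map_mpoly phi (shift E i)).
    apply/funext => i; rewrite /shift rmorphD /= map_mpolyX map_mpolyC.
    by congr (_ + _%:MP); exact: esym (phix (inr i)).
  have -> : newton g M = (fun i => map_mpoly phi (newton (fun i => G (Some i)) M i)).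
    apply/funext => i; rewrite map_newton (_ : (fun i => _) = g) //.
    by apply/funext => j; exact: phiG.
  by rewrite /F !map_mpoly_subst phiG.
have key M : ideal_add (in_gen_ideal (codom g)) (ideal_pow (vanish e) M) b <->
    forall m : 'X_{1..n}, (mdeg m < M)%N -> phi (F M)@_m = 0.
  split=> [/(newton_mem g0 gP dgP)/mpow_shift/mpow0P + m ltm | F0].
    by rewrite -phiF => /(_ m ltm); rewrite mcoeff_map_mpoly.
  apply/(newton_mem g0 gP dgP)/mpow_shift/mpow0P => m ltm.
  by rewrite -phiF mcoeff_map_mpoly; exact: F0.
(* The hypothesis at order [N0] makes the specialisation [phi] kill the first [K] terms, hence all
   of them. *)
have phia t : phi (a t) = 0.
  apply: (gen_least (Q := fun u => phi u = 0)) (aK t) => [|_ /mapP[i iK ->]].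
    split=> [|u v u0 v0|u v v0]; first exact: rmorph0.
      by rewrite rmorphD u0 v0 addr0.
    by rewrite rmorphM v0 mulr0.
  rewrite mem_iota in iK; rewrite /a; case E1: unpickle => [[M m]|]; last exact: rmorph0.
  case: ltnP => ltm; last exact: rmorph0.
  apply: (key M).1 ltm; case: bN0 => y [z [Jy Mz ->]]; exists y, z; split=> //.
  apply: ideal_pow_le Mz; rewrite /N0.
  have := @leq_bigmax _ (fun t : 'I_K => if unpickle t is Some (N, m) then
    let _ : 'X_{1..n} := m in N else 0%N) (Ordinal iK).
  by rewrite /= E1.
apply/key => m ltm.
by have := phia (pickle (N, m)); rewrite /a pickleK ltm.
Qed.

(** * Krull intersection *)

Section Krull.
Variables (k : fieldType) (n : nat) (e : 'I_n -> k).
Local Notation S := {mpoly k[n]}.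
Local Notation ev := (meval (fun i => 'X_i - (e i)%:MP : S)).

Lemma mpow_homog N f : ideal_pow (vanish e) N f ->
  exists2 p : {mpoly S[n]}, p \is N.-homog & ev p = f.
Proof.
elim: N f => [|N IHN] f fN.
  exists f%:MP; last exact: mevalC.
  by rewrite -[f%:MP]mulr1 mul_mpolyC; apply: rpredZ; exact: dhomog1.
apply: (fN (fun f => exists2 p : {mpoly S[n]}, p \is N.+1.-homog & ev p = f)).
  split=> [|_ _ [p hp <-] [q hq <-]|a _ [p hp <-]].
  - by exists 0; [exact: rpred0 | exact: meval0].
  - by exists (p + q); [exact: rpredD | exact: mevalD].
  - by exists (a *: p); [exact: rpredZ | exact: mevalZ].
move=> _ b /vanish_gen[c ->] /IHN[p hp <-].
exists ((\sum_i c i *: 'X_i) * p).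
  rewrite -add1n; apply: dhomogM => //; apply: rpred_sum => i _; apply: rpredZ.
  by rewrite dhomogX /= mdeg1.
rewrite mevalM; congr (_ * _); rewrite rmorph_sum; apply: eq_bigr => i _ /=.
by rewrite mevalZ mevalXU.
Qed.

(** At [e] all the [X_i - e_i] vanish, so only the constant coefficient of [p] survives, and it is
    zero. *)
Lemma vanish_homog N (p : {mpoly S[n]}) : p \is N.+1.-homog -> vanish e (ev p).
Proof.
move=> hp; rewrite /vanish; have <- : (p@_0).@[e] = (ev p).@[e].
  apply: (mpoly_morph_ext (phi := meval e \o mcoeff 0) (psi := meval e \o ev)) => [c|i] /=.
    by rewrite mcoeffC eqxx mulr1 mevalC.
  by rewrite mevalXU vanishX mcoeffX -mdeg_eq0 mdeg1 meval0.
by rewrite (dhomog_nemf_coeff hp) ?meval0 //= mdeg0.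
Qed.

Lemma pihomogM_homog (i j : nat) (p q : {mpoly S[n]}) : q \is j.-homog ->
  pihomog mdeg (i + j) (p * q) = pihomog mdeg i p * q.
Proof.
move=> hq; rewrite {1}(@pihomog_partitionE _ _ mdeg (maxn i.+1 (mmeasure mdeg p)) p) ?leq_maxr //.
have lti : (i < maxn i.+1 (mmeasure mdeg p))%N by rewrite leq_maxl.
rewrite mulr_suml linear_sum (bigD1 (Ordinal lti)) //= big1 ?addr0 => [|l ne].
  by rewrite pihomog_dE //; apply: dhomogM => //; exact: pihomogP.
apply: (pihomog_ne0 (d := (l + j)%N)); last by apply: dhomogM => //; exact: pihomogP.
by rewrite eqn_add2r; apply: contra ne => /eqP eqli; apply/eqP/val_inj.
Qed.

(* Perdry's proof: write [b] modulo [B] as a form of degree N in the [X_i - e_i],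
   for each N; a relation between these forms becomes [b = a * b] modulo [B]. *)
Lemma krull_point (B : seq S) b :
    (forall N, ideal_add (in_gen_ideal B) (ideal_pow (vanish e) N) b) ->
  exists2 a, vanish e a & in_gen_ideal B ((1 - a) * b).
Proof.
have iB := gen_is_ideal B.
move=> bN; have /choice[p pP] : forall N, exists p : {mpoly S[n]},
    p \is N.-homog /\ in_gen_ideal B (b - ev p).
  move=> N; have [x [y [Bx /mpow_homog[p hp <-] ->]]] := bN N.
  by exists p; rewrite addrK.
have [K pK] := mpoly_noetherian (n := n) (mpoly_noetherian (n := n) (@field_noetherian k)) p.
have [c cE] := gen_mkseqP (pK K).
(* Taking the part of degree [K] of the relation replaces its coefficients by forms of positive
   degree [K - i]; their values at the [X_i - e_i] vanish at [e]. *)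
have {}cE : p K = \sum_(i < K) pihomog mdeg (K - i) (c i) * p i.
  rewrite -[LHS](pihomog_dE (pP K).1) {1}cE linear_sum; apply: eq_bigr => i _ /=.
  by rewrite -{1}(subnK (ltnW (ltn_ord i))) pihomogM_homog //; case: (pP i).
pose q (i : 'I_K) := ev (pihomog mdeg (K - i) (c i)).
exists (\sum_i q i).
  apply: ideal_sum => [|i _]; first exact: vanish_ideal.
  have ltiK := ltn_ord i; rewrite /q -(@prednK (K - i)) ?subn_gt0 //.
  apply: vanish_homog; exact: pihomogP.
have -> : (1 - \sum_i q i) * b = (b - ev (p K)) - \sum_i q i * (b - ev (p i)).
  rewrite cE rmorph_sum mulrBl mul1r mulr_suml -addrA -opprD -big_split /=.
  by congr (_ - _); apply: eq_bigr => i _; rewrite rmorphM /= mulrBr addrC subrK.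
apply: (idealB iB); first by case: (pP K).
by apply: ideal_sum => // i _; apply: (idealMl _ iB); case: (pP i).
Qed.

End Krull.

(** * Local splitting of the conormal sequence *)

Section Splitting.
Variables (R : comNzRingType) (n : nat).
Local Notation S := {mpoly R[n]}.

(** For [s i] in [I], sending dx_i to [s i] gives a retraction, up to the factor [h], of the
    conormal map from I/I^2 to the differentials; this is the required identity on the class of
    [f]. *)
Definition splits (I : S -> Prop) (h : S) (s : 'I_n -> S) (f : S) : Prop :=
  ideal_mul I I (h * f - \sum_i f^`M(i) * s i).

(** Reduces the splitting to generators. For [a * f], the extra Leibniz term is [f] times a
    combination of the [s i], hence in the square of [I]. *)
Lemma splits_ideal I h s : is_ideal I -> (forall i, I (s i)) ->
  is_ideal (fun f => I f /\ splits I h s f).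
Proof.
move=> iI Is; have iI2 := ideal_mul_ideal I I.
split=> [|f g [If sf] [Ig sg]|a f [If sf]]; split.
- exact: ideal0.
- rewrite /splits mulr0 big1 ?subr0; first exact: (ideal0 iI2).
  by move=> i _; rewrite linear0 mul0r.
- exact: idealD.
- rewrite /splits; under eq_bigr do rewrite mderivD mulrDl.
  by rewrite big_split mulrDr opprD addrACA; exact: (idealD iI2).
- exact: idealMl.
- rewrite /splits; under eq_bigr do rewrite mderivM mulrDl -!mulrA [_ * (f * _)]mulrCA.
  rewrite big_split -!mulr_sumr opprD addrA addrAC mulrCA -mulrBr.
  apply: (idealB iI2); first exact: (idealMl _ iI2).
  apply: ideal_mul_in => //; apply: ideal_sum => // i _; exact: idealMl.
Qed.

End Splitting.

(** * Generators normalised at a point, and Cartier's induction on the order *)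

Section Local.
Variables (k : fieldType) (n : nat) (e : 'I_n -> k) (B : seq {mpoly k[n]}).
Local Notation S := {mpoly k[n]}.
Local Notation I := (in_gen_ideal B).
Local Notation mpow := (ideal_pow (vanish e)).
Hypothesis Be : forall b, b \in B -> vanish e b.

Definition jacobian : 'M[k]_(size B, n) := \matrix_(l, j) (B`_l)^`M(j).@[e].
(** With J the Jacobian matrix, [pinvmx] gives p with J p J = J; then G = p J p satisfies both J G J
    = J and G J G = G. *)
Definition ginv : 'M[k]_(n, size B) := pinvmx jacobian *m jacobian *m pinvmx jacobian.
(** A projection whose kernel is the tangent space at [e]. It is the Jacobian matrix of [gvec] at
    [e] and fixes [gvec], as Newton's iteration requires. *)
Definition tproj : 'M[k]_n := ginv *m jacobian.
Definition gvec : 'cV[S]_n := map_mx (@mpolyC n k) ginv *m \col_l B`_l.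

Lemma jacobianK : jacobian *m tproj = jacobian.
Proof.
have JpJ : jacobian *m pinvmx jacobian *m jacobian = jacobian by exact: mulmxKpV.
by rewrite /tproj /ginv; move: (pinvmx _) JpJ => p JpJ; rewrite !mulmxA JpJ JpJ.
Qed.

Lemma tproj_ginv : tproj *m ginv = ginv.
Proof.
have JpJ : jacobian *m pinvmx jacobian *m jacobian = jacobian by exact: mulmxKpV.
rewrite /tproj /ginv; move: (pinvmx _) JpJ => p JpJ.
have JpJr m (X : 'M_(n, m)) : jacobian *m (p *m (jacobian *m X)) = jacobian *m X.
  by rewrite !mulmxA JpJ.
by rewrite -!mulmxA !JpJr.
Qed.

Lemma tproj_idem : tproj *m tproj = tproj.
Proof. by rewrite {2}/tproj mulmxA tproj_ginv. Qed.

Lemma gvecE i : gvec i 0 = \sum_l (ginv i l)%:MP * B`_l.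
Proof. by rewrite mxE; apply: eq_bigr => l _; rewrite !mxE. Qed.

Lemma gvec_mem i : I (gvec i 0).
Proof.
rewrite gvecE; apply: ideal_sum; first exact: gen_is_ideal.
by move=> l _; apply: in_gen_idealM; apply/mem_gen/mem_nth.
Qed.

Lemma gvec_size d i : (forall b, b \in B -> msize b <= d)%N -> (msize (gvec i 0)%R <= d)%N.
Proof.
move=> szB; rewrite gvecE; apply: leq_trans (msize_sum _ _ _) _.
apply/bigmax_leqP => l _; rewrite mul_mpolyC; apply: leq_trans (msizeZ_le _ _) _.
by apply/szB/mem_nth.
Qed.

Lemma I_vanish f : I f -> vanish e f.
Proof. exact: gen_least (vanish_ideal e) Be. Qed.

Lemma gvec_proj : map_mx (@mpolyC n k) tproj *m gvec = gvec.
Proof. by rewrite /gvec mulmxA -map_mxM tproj_ginv. Qed.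

Lemma gvec_projE i : gvec i 0 = \sum_j (tproj i j)%:MP * gvec j 0.
Proof. by rewrite -{1}gvec_proj mxE; apply: eq_bigr => l _; rewrite !mxE. Qed.

Lemma gvec_deriv i j : (gvec i 0)^`M(j).@[e] = tproj i j.
Proof.
rewrite gvecE (raddf_sum (mderiv j)) (raddf_sum (meval e)) mxE; apply: eq_bigr => l _ /=.
by rewrite mderiv_mulC mevalM mevalC [jacobian _ _]mxE.
Qed.

Local Notation J := (in_gen_ideal (codom (fun i => gvec i 0))).

Lemma gvec_sub f : J f -> I f.
Proof.
by apply: gen_least (gen_is_ideal B) _ => _ /codomP[i ->]; apply: gvec_mem.
Qed.

Hypothesis tangent : forall v : 'I_n -> k,
  (forall b, b \in B -> \sum_j b^`M(j).@[e] * v j = 0) ->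
  exists2 theta : 'I_n -> S, forall i, (theta i).@[e] = v i &
    forall f, I f -> I (\sum_i theta i * f^`M(i)).

(* The derivations with value [1 - tproj] at [e] combine, modulo [gvec] and up
   to order, into the Euler operator, which acts as [N] on [m^N / m^N.+1]. *)
Lemma cartier_step N : (N.+1)%:R != 0 :> k ->
  (forall f, I f -> ideal_add J (mpow N.+1) f) ->
  forall f, I f -> ideal_add J (mpow N.+2) f.
Proof.
move=> nzN IH f If; have iJ := gen_is_ideal (codom (fun i => gvec i 0)).
have iM N' := ideal_pow_ideal (vanish e) N'.
have iT N' := ideal_add_ideal iJ (iM N').
have [x [y [Jx My fE]]] := IH f If.
have Iy : I y.
  have -> : y = f - x by rewrite fE addrC addKr.
  apply: idealB => //; [exact: gen_is_ideal | exact: gvec_sub].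
rewrite fE; apply: (idealD (iT _)); first exact: ideal_addl.
pose X i : S := 'X_i - (e i)%:MP.
(* The columns of [1 - tproj] are tangent vectors, by [jacobianK]. *)
have /choice[theta thetaP] : forall j, exists theta : 'I_n -> S,
    (forall i, (theta i).@[e] = (i == j)%:R - tproj i j) /\
    (forall f, I f -> I (\sum_i theta i * f^`M(i))).
  move=> j; have [|theta th1 th2] := tangent (v := fun i => (i == j)%:R - tproj i j).
    move=> b /(nthP 0)[l ltl <-].
    have /matrixP/(_ (Ordinal ltl) j) := jacobianK; rewrite !mxE /= => JP.
    under eq_bigr do rewrite mulrBr; rewrite sumrB (bigD1 j) //= eqxx mulr1 big1 ?addr0.
      by rewrite -JP -sumrB big1 // => i _; rewrite mxE subrr.
    by move=> i /negPf ->; rewrite mulr0.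
  by exists theta.
(* Each derivative of [y] along [theta j] is again in [I], so that [IH] applies to it; the factor
   [X j] gains one order. *)
have TD : ideal_add J (mpow N.+2) (\sum_j X j * \sum_i theta j i * y^`M(i)).
  apply: ideal_sum => // j _; have [_ thI] := thetaP j.
  have [u [v [Ju Mv ->]]] := IH _ (thI y Iy).
  rewrite mulrDr; apply: (idealD (iT _)).
    by apply: ideal_addl => //; apply: (idealMl _ iJ).
  by apply: ideal_addr => //; apply: ideal_mul_in => //; apply: vanishX.
(* To first order, the combined vector field has components X_i - sum_j tproj_ij X_j, and the
   subtracted sum is the linear part of [gvec i 0]. *)
have M2 i : mpow 2 (\sum_j X j * theta j i - X i + gvec i 0).
  have := vanish_taylor (I_vanish (gvec_mem i)).
  under eq_bigr do rewrite gvec_deriv.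
  move=> T2; have -> : \sum_j X j * theta j i - X i + gvec i 0 =
      \sum_j X j * (theta j i - ((theta j i).@[e])%:MP)
      + (gvec i 0 - \sum_j (tproj i j)%:MP * X j).
    under [in RHS]eq_bigr => j _ do rewrite (thetaP j).1 mpolyCB mulrBr mulrBr.
    have -> : X i = \sum_j X j * ((i == j)%:R)%:MP.
      rewrite (bigD1 i) //= eqxx mpolyC1 mulr1 big1 ?addr0 // => j /negPf ji.
      by rewrite eq_sym ji mpolyC0 mulr0.
    have -> : \sum_j (tproj i j)%:MP * X j = \sum_j X j * (tproj i j)%:MP.
      by apply: eq_bigr => j _; rewrite mulrC.
    by rewrite !sumrB; ring.
  apply: (idealD (iM 2)) => //.
  apply: ideal_sum => // j _; apply: ideal_mul_in; first exact: vanishX.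
  by apply/ideal_pow1; [exact: vanish_ideal | exact: vanishB].
have TN : ideal_add J (mpow N.+2) (y *+ N.+1).
  have -> : y *+ N.+1 = \sum_j X j * (\sum_i theta j i * y^`M(i))
    - (\sum_i (\sum_j X j * theta j i - X i + gvec i 0) * y^`M(i))
    + \sum_i gvec i 0 * y^`M(i) - (\sum_i X i * y^`M(i) - y *+ N.+1).
    have -> : \sum_j X j * (\sum_i theta j i * y^`M(i)) =
        \sum_i (\sum_j X j * theta j i) * y^`M(i).
      under eq_bigr do rewrite mulr_sumr.
      rewrite exchange_big; apply: eq_bigr => i _; rewrite mulr_suml.
      by apply: eq_bigr => j _; rewrite mulrA.
    under [X in _ - X + _]eq_bigr do rewrite mulrDl mulrBl.
    by rewrite big_split sumrB /=; ring.
  apply: (idealB (iT _)); last by apply: ideal_addr => //; exact: mpow_euler.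
  apply: (idealD (iT _)); last first.
    apply: ideal_addl => //; apply: ideal_sum => // i _; apply: (idealMr _ iJ).
    exact/mem_gen/(codom_f (fun i => gvec i 0)).
  apply: (idealB (iT _)) => //; apply: ideal_addr => //; apply: ideal_sum => // i _.
  by apply: (@ideal_powD _ _ 2 N) => //; exact: mpow_deriv.
have -> : y = (N.+1%:R^-1)%:MP * (y *+ N.+1).
  by rewrite -[y *+ _]mulr_natl mulrA -mpolyC_nat -mpolyCM mulVf // mpolyC1 mul1r.
exact: (idealMl _ (iT _)).
Qed.

(** The induction starts at order 1, where [I] vanishes at [e]. Passing from order m to m + 1
    divides by m, so reaching order N needs 1, ..., N - 1 invertible. *)
Lemma cartier N : (forall m, (0 < m < N)%N -> m%:R != 0 :> k) ->
  forall f, I f -> ideal_add J (mpow N) f.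
Proof.
have iJ := gen_is_ideal (codom (fun i => gvec i 0)).
case: N => [|N] nz; first by move=> f _; exact: ideal_addr.
elim: N nz => [_ f If|N IHN nz].
  apply: ideal_addr => //; apply/ideal_pow1; [exact: vanish_ideal | exact: I_vanish].
apply: cartier_step; first by apply: nz => /=.
by apply: IHN => m /andP[m0 ltm]; apply: nz; rewrite m0 ltnS ltnW.
Qed.

(** [h] is the product of the factors 1 - a given by Krull's theorem for the members of [C]. The
    list [C] is separate from [B] so that the induction leaves [J] unchanged. *)
Lemma local_clear (C : seq S) : {subset C <= B} ->
  (forall b, b \in B -> forall N, ideal_add J (mpow N) b) ->
  exists2 h : S, h.@[e] = 1 & forall b, b \in C -> J (h * b).
Proof.
move=> CB BJ; elim: C CB => [|c C IHC] CB; first by exists 1; rewrite ?meval1.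
have [|h h1 hC] := IHC; first by move=> x xC; apply: CB; rewrite inE xC orbT.
have [a a0 aJ] := krull_point (BJ c (CB c (mem_head _ _))).
exists ((1 - a) * h); first by rewrite mevalM mevalB meval1 a0 h1 subr0 mul1r.
move=> b; rewrite inE => /predU1P[-> | /hC bJ].
  by rewrite mulrAC; apply: idealMr => //; exact: gen_is_ideal.
by rewrite -mulrA; apply: idealMl => //; exact: gen_is_ideal.
Qed.

Lemma local_splitting : (forall b, b \in B -> forall N, ideal_add J (mpow N) b) ->
  exists h, exists s : 'I_n -> S,
    [/\ h.@[e] = 1, forall i, I (s i) & forall f, I f -> splits I h s f].
Proof.
move=> BJ; have [h1 h1e h1J] := local_clear (fun b => id) BJ.
have iI := gen_is_ideal B.
pose P : 'M[S]_n := map_mx (@mpolyC n k) tproj.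
pose dg : 'M[S]_n := \matrix_(i, j) (gvec i 0)^`M(j).
(* As [dg] equals [P] at [e], [M] is the identity there. From (1 - P) M = 1 - P and P g = g one gets
   dg adj(M) g = det(M) g, which splits the ideal [J] up to the factor det(M). *)
pose M := 1%:M - P + dg.
have Pg : P *m gvec = gvec by exact: gvec_proj.
have Pdg : P *m dg = dg.
  apply/matrixP => i j; rewrite [RHS]mxE [LHS]mxE [in RHS]gvec_projE.
  rewrite (raddf_sum (mderiv j)); apply: eq_bigr => l _ /=.
  by rewrite [P _ _]mxE [dg _ _]mxE mderiv_mulC.
have PP : P *m P = P by rewrite -map_mxM tproj_idem.
pose s := \adj M *m gvec.
have dgs : dg *m s = \det M *: gvec.
  have PM : (1%:M - P) *m M = 1%:M - P.
    rewrite mulmxDr !mulmxBl !mul1mx mulmxBr mulmx1 PP Pdg !subrr subr0.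
    by rewrite addr0.
  have PA : (1%:M - P) *m \adj M = \det M *: (1%:M - P).
    by rewrite -{1}PM -mulmxA mul_mx_adj mul_mx_scalar.
  have -> : dg = M - (1%:M - P) by rewrite /M [_ + dg]addrC addrK.
  have Qg : (1%:M - P) *m gvec = 0 by rewrite mulmxBl mul1mx Pg subrr.
  by rewrite /s mulmxA mulmxBl mul_mx_adj PA mulmxBl mul_scalar_mx -scalemxAl Qg scaler0 subr0.
have sI i : I (s i 0).
  rewrite mxE; apply: ideal_sum => // j _; apply: (idealMl _ iI); exact: gvec_mem.
have det1 : (\det M).@[e] = 1.
  rewrite -[LHS]det_map_mx (_ : map_mx _ _ = 1%:M) ?det1 //.
  apply/matrixP => i j; rewrite [LHS]mxE [M i j]mxE [dg i j]mxE.
  rewrite [(_ - P) i j]mxE [(- P) i j]mxE [P i j]mxE ![1%:M i j]mxE /=.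
  rewrite mevalD mevalB mevalC gvec_deriv.
  by rewrite subrK; case: (i == j); rewrite ?meval1 ?meval0.
pose T f := I f /\ splits I (\det M) (fun i => s i 0) f.
have iT : is_ideal T by exact: splits_ideal.
have TJ f : J f -> T f.
  apply: gen_least iT _ => _ /codomP[i ->]; split; first exact: gvec_mem.
  rewrite /splits; suff -> : \sum_j (gvec i 0)^`M(j) * s j 0 = \det M * gvec i 0.
    by rewrite subrr; exact: (ideal0 (ideal_mul_ideal I I)).
  have /matrixP/(_ i 0) := dgs; rewrite [RHS]mxE [LHS]mxE => <-.
  by apply: eq_bigr => j _; rewrite [dg _ _]mxE.
exists (h1 * \det M), (fun i => h1 * s i 0); split=> [|i|].
- by rewrite mevalM h1e det1 mul1r.
- exact: idealMl.
have iI2 := ideal_mul_ideal I I.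
pose Q f := I f /\ splits I (h1 * \det M) (fun i => h1 * s i 0) f.
move=> f If; suff [] : Q f by [].
apply: (gen_least (Q := Q)) If => [|b bB]; first by apply: splits_ideal => // i; exact: idealMl.
split; first exact: mem_gen.
(* Passing from [h1 * b] in [J] to [b] differs by [b] times derivatives of [h1] times the [s i], an
   element of the square of [I]. *)
have [_ sp] := TJ _ (h1J b bB); rewrite /splits in sp *.
have -> : h1 * \det M * b - \sum_i b^`M(i) * (h1 * s i 0) =
    (\det M * (h1 * b) - \sum_i (h1 * b)^`M(i) * s i 0) + b * \sum_i h1^`M(i) * s i 0.
  have -> : \sum_i (h1 * b)^`M(i) * s i 0 =
      b * (\sum_i h1^`M(i) * s i 0) + \sum_i b^`M(i) * (h1 * s i 0).
    rewrite mulr_sumr -big_split; apply: eq_bigr => i _ /=.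
    by rewrite mderivM; ring.
  by ring.
apply: (idealD iI2) => //; apply: ideal_mul_in; first exact: mem_gen.
by apply: ideal_sum => // i _; exact: idealMl.
Qed.

End Local.

(** * Tensor squares *)

Lemma ord_split_ind m n (P : 'I_(m + n) -> Prop) :
  (forall i, P (lshift n i)) -> (forall i, P (rshift m i)) -> forall i, P i.
Proof. by move=> Pl Pr i; rewrite -(splitK i); case: split => j /=. Qed.

Definition pair_pt T m n (u : 'I_m -> T) (v : 'I_n -> T) (i : 'I_(m + n)) : T :=
  match split i with inl j => u j | inr j => v j end.

Lemma pair_ptl T m n (u : 'I_m -> T) (v : 'I_n -> T) i : pair_pt u v (lshift n i) = u i.
Proof. by rewrite /pair_pt (unsplitK (inl i)). Qed.

Lemma pair_ptr T m n (u : 'I_m -> T) (v : 'I_n -> T) i : pair_pt u v (rshift m i) = v i.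
Proof. by rewrite /pair_pt (unsplitK (inr i)). Qed.

Section Tensor.
Variables (k : fieldType).
Local Notation subst := (mmap (@mpolyC _ k)).

Lemma eq_subst n m (h h' : 'I_n -> {mpoly k[m]}) f : h =1 h' -> subst h f = subst h' f.
Proof. by move=> /funext ->. Qed.

Lemma eq_subst_pair m n r (u u' : 'I_m -> {mpoly k[r]}) (v v' : 'I_n -> {mpoly k[r]}) p :
  u =1 u' -> v =1 v' -> subst (pair_pt u v) p = subst (pair_pt u' v') p.
Proof. by move=> /funext -> /funext ->. Qed.

Lemma lrmorph_subst n m (phi : {lrmorphism {mpoly k[n]} -> {mpoly k[m]}}) f :
  phi f = subst (fun i => phi 'X_i) f.
Proof.
apply: (mpoly_morph_ext (phi := phi) (psi := subst (fun i => phi 'X_i))) => [c|i] /=.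
  by rewrite mmapC -alg_mpolyC linearZ /= rmorph1 alg_mpolyC.
by rewrite mmapX mmap1U.
Qed.

Lemma tens_inlE m n (f : {mpoly k[m]}) : tens_inl n f = subst (fun i => 'X_(lshift n i)) f.
Proof. by congr (mmap _ _ f); apply/funext => i; rewrite tnth_mktuple. Qed.

Lemma tens_inrE m n (f : {mpoly k[n]}) : tens_inr m f = subst (fun i => 'X_(rshift m i)) f.
Proof. by congr (mmap _ _ f); apply/funext => i; rewrite tnth_mktuple. Qed.

Lemma tens_elimE m n r (u : {mpoly k[m]} -> {mpoly k[r]}) (v : {mpoly k[n]} -> {mpoly k[r]}) p :
  tens_elim u v p = subst (pair_pt (fun i => u 'X_i) (fun i => v 'X_i)) p.
Proof.
congr (mmap _ _ p); apply/funext; apply: ord_split_ind => i.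
  by rewrite pair_ptl tnth_lshift tnth_mktuple.
by rewrite pair_ptr tnth_rshift tnth_mktuple.
Qed.

Lemma subst_pair_inl m n r (u : 'I_m -> {mpoly k[r]}) (v : 'I_n -> {mpoly k[r]}) f :
  subst (pair_pt u v) (tens_inl n f) = subst u f.
Proof.
rewrite tens_inlE subst_subst; apply: eq_subst => i.
by rewrite mmapX mmap1U pair_ptl.
Qed.

Lemma subst_pair_inr m n r (u : 'I_m -> {mpoly k[r]}) (v : 'I_n -> {mpoly k[r]}) f :
  subst (pair_pt u v) (tens_inr m f) = subst v f.
Proof.
rewrite tens_inrE subst_subst; apply: eq_subst => i.
by rewrite mmapX mmap1U pair_ptr.
Qed.

Lemma subst_pair m n r s (w : 'I_r -> {mpoly k[s]}) (u : 'I_m -> {mpoly k[r]})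
    (v : 'I_n -> {mpoly k[r]}) p :
  subst w (subst (pair_pt u v) p) =
  subst (pair_pt (fun i => subst w (u i)) (fun i => subst w (v i))) p.
Proof.
rewrite subst_subst; apply: eq_subst; apply: ord_split_ind => i.
  by rewrite !pair_ptl.
by rewrite !pair_ptr.
Qed.

Variable n : nat.
Local Notation S := {mpoly k[n]}.
Local Notation S2 := {mpoly k[n + n]}.
Local Notation inl := (@tens_inl k n n).
Local Notation inr := (@tens_inr k n n).
Variable B : seq S.
Local Notation I := (in_gen_ideal B).
Local Notation Ix := (in_gen_ideal (map inl B)).
Local Notation Iy := (in_gen_ideal (map inr B)).

Lemma inl_mem f : I f -> Ix (inl f).
Proof.
apply: (gen_least (Q := Ix \o inl)) => [|b bB]; last exact/mem_gen/map_f.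
by rewrite /comp /tens_inl; apply: ideal_preim; exact: gen_is_ideal.
Qed.

Lemma inr_mem f : I f -> Iy (inr f).
Proof.
apply: (gen_least (Q := Iy \o inr)) => [|b bB]; last exact/mem_gen/map_f.
by rewrite /comp /tens_inr; apply: ideal_preim; exact: gen_is_ideal.
Qed.

Let inlM f g : inl (f * g) = inl f * inl g.
Proof. by rewrite /tens_inl rmorphM. Qed.

Let inrM f g : inr (f * g) = inr f * inr g.
Proof. by rewrite /tens_inr rmorphM. Qed.

Let inlC c : inl c%:MP = c%:MP.
Proof. by rewrite /tens_inl comp_mpolyC. Qed.

Let inrC c : inr c%:MP = c%:MP.
Proof. by rewrite /tens_inr comp_mpolyC. Qed.

(* [S2] as polynomials in the first variables over the second ones. *)
Let theta : {rmorphism S2 -> {mpoly S[n]}} :=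
  mmap (@mpolyC n S \o @mpolyC n k) (pair_pt (fun i => 'X_i) (fun i => ('X_i)%:MP)).

Let theta_inl f : theta (inl f) = map_mpoly (@mpolyC n k) f.
Proof.
rewrite tens_inlE; apply: (mpoly_morph_ext
  (phi := mmap (@mpolyC n S \o @mpolyC n k) (pair_pt (fun i => 'X_i) (fun i => ('X_i)%:MP))
    \o subst (fun i => 'X_(lshift n i)))
  (psi := map_mpoly (@mpolyC n k))) => [c|i] /=.
  by rewrite !mmapC /= map_mpolyC.
by rewrite map_mpolyX mmapX mmap1U mmapX mmap1U pair_ptl.
Qed.

Let theta_inr f : theta (inr f) = f%:MP.
Proof.
rewrite tens_inrE; apply: (mpoly_morph_ext
  (phi := mmap (@mpolyC n S \o @mpolyC n k) (pair_pt (fun i => 'X_i) (fun i => ('X_i)%:MP))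
    \o subst (fun i => 'X_(rshift n i)))
  (psi := @mpolyC n S)) => [c|i] /=.
  by rewrite !mmapC.
by rewrite mmapX mmap1U mmapX mmap1U pair_ptr.
Qed.

Let theta_Iy p m : Iy p -> I (theta p)@_m.
Proof.
have iI := gen_is_ideal B.
move=> Ip; move: m; apply: (gen_least (Q := fun p => forall m, I (theta p)@_m)) Ip.
  split=> [m|x y hx hy m|a x hx m].
  - by rewrite rmorph0 mcoeff0; exact: (ideal0 iI).
  - by rewrite rmorphD mcoeffD; exact: (idealD iI (hx m) (hy m)).
  - rewrite rmorphM mcoeffM; apply: ideal_sum => // i _.
    exact: (idealMl _ iI (hx _)).
move=> _ /mapP[b bB ->] m; rewrite theta_inr mcoeffC; apply: idealMr => //; exact: mem_gen.
Qed.

Let decomp p : Ix p -> exists2 s : seq (S * S),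
  (forall t, t \in s -> I t.1) & p = \sum_(t <- s) inl t.1 * inr t.2.
Proof.
pose Q p := exists2 s : seq (S * S),
  (forall t, t \in s -> I t.1) & p = \sum_(t <- s) inl t.1 * inr t.2.
have QD x y : Q x -> Q y -> Q (x + y).
  move=> [s sI ->] [t tI ->]; exists (s ++ t); last by rewrite big_cat.
  by move=> u; rewrite mem_cat => /orP[/sI | /tI].
have QM a b x : Q x -> Q (inl a * inr b * x).
  move=> [s sI ->]; exists [seq (a * t.1, b * t.2) | t <- s].
    by move=> _ /mapP[t ts ->] /=; apply: in_gen_idealM; exact: sI.
  rewrite big_map mulr_sumr; apply: eq_bigr => t _.
  by rewrite /= inlM inrM mulrACA.
move=> Ip; suff : Q p by [].
apply: (gen_least (Q := Q)) Ip => [|_ /mapP[b bB ->]]; last first.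
  exists [:: (b, 1)] => [t|]; first by rewrite inE => /eqP ->; exact: mem_gen.
  by rewrite big_seq1 /= /tens_inr rmorph1 mulr1.
split=> // [|a x Qx]; first by exists [::]; rewrite ?big_nil.
elim/mpoly_ind_alg: a x Qx => [c|i|p1 p2 IH1 IH2|p1 p2 IH1 IH2] x Qx.
- have := QM c%:MP 1 _ Qx.
  by rewrite inlC /tens_inr rmorph1 mulr1.
- elim/ord_split_ind: i => i.
    by have := QM 'X_i 1 _ Qx; rewrite tens_inlE mmapX mmap1U /tens_inr rmorph1 mulr1.
  by have := QM 1 'X_i _ Qx; rewrite tens_inrE mmapX mmap1U /tens_inl rmorph1 mul1r.
- by rewrite mulrDl; apply: QD; [exact: IH1 | exact: IH2].
- by rewrite -mulrA; apply: IH1; exact: IH2.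
Qed.

(* Eliminate the terms [u (x) v] one at a time: a coefficient of [u] expresses
   [v] modulo [I] in terms of the second factors of the other terms. *)
Lemma tens_ideal_cap p : Ix p -> Iy p -> ideal_mul Ix Iy p.
Proof.
have iX := gen_is_ideal (map inl B); have iY := gen_is_ideal (map inr B).
have iXY := ideal_mul_ideal Ix Iy; have iI := gen_is_ideal B.
move=> /decomp[s]; have [N] := ubnP (size s); elim: N s p => // N IHN [|[u v] s] p /= szs sI ->.
  by rewrite big_nil => _; exact: ideal0.
rewrite big_cons /=; have uI := sI _ (mem_head _ _).
have sI' t : t \in s -> I t.1 by move=> ts; apply: sI; rewrite inE ts orbT.
have [-> | nzu] := eqVneq u 0.
  have -> : inl 0 = 0 by rewrite /tens_inl rmorph0.
  rewrite mul0r add0r => Iyp.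
  exact: (IHN s _ szs sI' erefl Iyp).
have [m nzm] : exists m, u@_m != 0.
  apply: contrapT => none; move: nzu => /eqP[]; apply/mpolyP => m; rewrite mcoeff0.
  by apply/eqP; apply: contrapT => /negP ne; apply: none; exists m.
set a := u@_m in nzm; move=> Iyp.
(* The coefficient at [m] of the whole sum, in the first variables. Solving for [v] removes one term
   and modifies the first factors of the others by multiples of [u], which keeps them in [I]. *)
pose w := a%:MP * v + \sum_(t <- s) (t.1@_m)%:MP * t.2.
have wI : I w.
  have coefE (f g : S) : (theta (inl f * inr g))@_m = (f@_m)%:MP * g.
    by rewrite rmorphM theta_inl theta_inr mulrC mcoeffCM mcoeff_map_mpoly mulrC.
  have := theta_Iy m Iyp.
  suff <- : w = (theta (inl u * inr v + \sum_(t <- s) inl t.1 * inr t.2))@_m by [].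
  rewrite rmorphD rmorph_sum mcoeffD; congr (_ + _); first exact/esym/coefE.
  by rewrite (raddf_sum (mcoeff m)); apply: eq_bigr => t _; exact/esym/coefE.
pose s' := [seq (t.1 - (a^-1 * t.1@_m)%:MP * u, t.2) | t <- s].
have sE : inl u * inr v + \sum_(t <- s) inl t.1 * inr t.2 =
    inl (a^-1%:MP * u) * inr w + \sum_(t <- s') inl t.1 * inr t.2.
  rewrite big_map /=.
  have -> : \sum_(t <- s) inl (t.1 - (a^-1 * t.1@_m)%:MP * u) * inr t.2 =
     \sum_(t <- s) inl t.1 * inr t.2
     - inl (a^-1%:MP * u) * \sum_(t <- s) inr ((t.1@_m)%:MP * t.2).
    rewrite mulr_sumr -sumrB; apply: eq_bigr => t _.
    have alg (x y z c c' : S2) : (x - c * c' * y) * z = x * z - c * y * (c' * z) by ring.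
    rewrite !inlM inrM !inlC inrC -alg -mpolyCM -inlC -inlM.
    by rewrite /tens_inl rmorphB.
  have -> : inr w = a%:MP * inr v + \sum_(t <- s) inr ((t.1@_m)%:MP * t.2).
    by rewrite -inrC -inrM /tens_inr rmorphD rmorph_sum.
  rewrite inlM inlC mulrDr [_ * inl u * (_ * _)]mulrACA -mpolyCM mulVf // mpolyC1 mul1r.
  have alg (x y z : S2) : x + y = x + z + (y - z) by ring.
  exact: alg.
rewrite sE; have w1 : ideal_mul Ix Iy (inl (a^-1%:MP * u) * inr w).
  by apply: ideal_mul_in; [apply: inl_mem; exact: in_gen_idealM | exact: inr_mem].
apply: (idealD iXY) => //; apply: (IHN s' _ _ _ erefl); first by rewrite size_map.
  by move=> _ /mapP[t ts ->] /=; apply: idealB => //; [exact: sI' | exact: in_gen_idealM].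
have := Iyp; rewrite sE => /(fun h => idealB iY h (ideal_mulSr iY w1)).
by rewrite addrAC subrr add0r.
Qed.

End Tensor.

(** * Invariant derivations and translations *)

Section Hopf.
Variables (k : fieldType) (n : nat) (H : hopf_quadruple k n).
Local Notation S := {mpoly k[n]}.
Local Notation S2 := {mpoly k[n + n]}.
Local Notation B := (hgens H).
Local Notation I := (in_gen_ideal B).
Local Notation inl := (@tens_inl k n n).
Local Notation inr := (@tens_inr k n n).
Local Notation subst := (mmap (@mpolyC _ k)).

Definition unit_pt (i : 'I_n) : k := hcounit H 'X_i.
Local Notation e := unit_pt.
Local Notation ec := (fun i => (unit_pt i)%:MP).

Lemma counitE f : hcounit H f = f.@[e].
Proof.
apply: (mpoly_morph_ext (phi := hcounit H : {rmorphism S -> k}) (psi := meval e)) => [c|i] /=.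
  by rewrite -alg_mpolyC linearZ /= rmorph1 mevalZ meval1.
by rewrite mevalXU.
Qed.

Lemma ideal_unit f : I f -> vanish e f.
Proof. by move=> If; rewrite /vanish -counitE; apply: (hopf_counit_ideal (hopfP H)). Qed.

Lemma comul_counitr f : I (subst (pair_pt (fun i => 'X_i) ec) (hcomul H f) - f).
Proof. by have := hopf_counitr (hopfP H) f; rewrite /eq_mod_gen tens_elimE. Qed.

Lemma comul_counitl f : I (subst (pair_pt ec (fun i => 'X_i)) (hcomul H f) - f).
Proof. by have := hopf_counitl (hopfP H) f; rewrite /eq_mod_gen tens_elimE. Qed.

Section Derivation.
Variable v : 'I_n -> k.
Hypothesis tanv : forall b, b \in B -> \sum_j b^`M(j).@[e] * v j = 0.
Local Notation xe := (subst (pair_pt (fun i => 'X_i) ec)).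
Local Notation ex := (subst (pair_pt ec (fun i => 'X_i))).

Let E (p : S2) : S := \sum_j xe p^`M(rshift n j) * (v j)%:MP.

Let EC c : E c%:MP = 0.
Proof. by rewrite /E big1 // => j _; rewrite mderivC mmap0 mul0r. Qed.

Let ED p q : E (p + q) = E p + E q.
Proof.
by rewrite -big_split; apply: eq_bigr => j _ /=; rewrite mderivD mmapD mulrDl.
Qed.

Let EM p q : E (p * q) = E p * xe q + xe p * E q.
Proof.
rewrite mulr_suml mulr_sumr -big_split; apply: eq_bigr => j _ /=.
rewrite mderivM rmorphD !rmorphM /= mulrDl.
by congr (_ + _); [exact: mulrAC | exact/esym/mulrA].
Qed.

Let E_inlX i : E 'X_(lshift n i) = 0.
Proof.
rewrite /E big1 // => j _; rewrite mderivXU eq_lrshift.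
by rewrite rmorph0 mul0r.
Qed.

Let E_inrX i : E 'X_(rshift n i) = (v i)%:MP.
Proof.
rewrite /E (bigD1 i) //= mderivXU eqxx rmorph1 mul1r big1 ?addr0 // => j ji.
by rewrite mderivXU eq_rshift eq_sym (negPf ji) rmorph0 mul0r.
Qed.

Let E_subst m (h : 'I_m -> S2) f :
  E (subst h f) = \sum_i xe (subst h f^`M(i)) * E (h i).
Proof.
rewrite -[LHS]/((E \o subst h) f) (derivation_along (phi := xe \o subst h)) /=.
- by apply: eq_bigr => i _; rewrite mmapX mmap1U.
- by move=> c; rewrite mmapC EC.
- by move=> p q; rewrite mmapD ED.
- by move=> p q; rewrite rmorphM EM.
Qed.

(** [E] kills functions of x alone; on a generator in y it gives the constant sum of the d_j c(e)
    v_j, zero by tangency. *)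
Let E_ideal p : in_gen_ideal (gens2 B) p -> I (E p).
Proof.
have iI := gen_is_ideal B; move=> Ip; suff [] : I (E p) /\ I (xe p) by [].
apply: (gen_least (Q := fun p => I (E p) /\ I (xe p))) Ip => [|b].
  split=> [|x y [Ex xx] [Ey xy]|a x [Ex xx]]; split.
  - by rewrite -mpolyC0 EC; exact: (ideal0 iI).
  - by rewrite rmorph0; exact: (ideal0 iI).
  - by rewrite ED; exact: (idealD iI).
  - by rewrite rmorphD; exact: (idealD iI).
  - by rewrite EM; apply: (idealD iI); exact: (idealMl _ iI).
  - by rewrite rmorphM; exact: (idealMl _ iI).
rewrite mem_cat => /orP[] /mapP[c cB ->].
  rewrite subst_pair_inl subst_id; split; last exact: mem_gen.
  rewrite tens_inlE E_subst big1 => [|i _]; first exact: (ideal0 iI).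
  by rewrite E_inlX mulr0.
rewrite subst_pair_inr subst_const (ideal_unit (mem_gen cB)); split; last exact: (ideal0 iI).
rewrite tens_inrE E_subst.
under eq_bigr do rewrite -tens_inrE subst_pair_inr subst_const E_inrX -mpolyCM.
have -> : \sum_i (c^`M(i).@[e] * v i)%:MP = (\sum_i c^`M(i).@[e] * v i)%:MP :> S.
  by rewrite raddf_sum.
by rewrite tanv // mpolyC0; exact: (ideal0 iI).
Qed.

Let xe_ex p : (xe p).@[e] = (ex p).@[e].
Proof.
rewrite !subst_meval; apply: meval_eq; apply: ord_split_ind => i.
  by rewrite !pair_ptl mevalC mevalXU.
by rewrite !pair_ptr mevalC mevalXU.
Qed.

(** Both sides are derivations along the evaluation at (e, e), so comparing them on the variables
    suffices. *)
Let E_pt p : (E p).@[e] = \sum_j (ex p)^`M(j).@[e] * v j.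
Proof.
pose D p := \sum_j (ex p)^`M(j).@[e] * v j.
rewrite -/(D p) -[LHS]/((meval e \o E) p).
rewrite (derivation_along (phi := meval e \o xe)) /=; first last.
- by move=> x y; rewrite EM mevalD !mevalM.
- by move=> x y; rewrite ED mevalD.
- by move=> c; rewrite EC meval0.
rewrite [RHS](derivation_along (phi := meval e \o xe) (D := D)) /=; first last.
- move=> x y; rewrite /D mulr_suml mulr_sumr -big_split; apply: eq_bigr => j _ /=.
  rewrite !xe_ex rmorphM mderivM mevalD !mevalM /= mulrDl.
  by congr (_ + _); [exact: mulrAC | exact/esym/mulrA].
- move=> x y; rewrite /D -big_split; apply: eq_bigr => j _ /=.
  by rewrite mmapD mderivD mevalD mulrDl.
- by move=> c; rewrite /D big1 // => j _; rewrite mmapC mderivC meval0 mul0r.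
apply: eq_bigr => i _; congr (_ * _); elim/ord_split_ind: i => i.
  rewrite E_inlX meval0 /D big1 // => j _.
  by rewrite mmapX mmap1U pair_ptl mderivC meval0 mul0r.
rewrite E_inrX mevalC /D (bigD1 i) //= mmapX mmap1U pair_ptr mderivXU eqxx meval1 mul1r.
rewrite big1 ?addr0 // => j /negPf ji.
by rewrite mderivXU eq_sym ji meval0 mul0r.
Qed.

(* The derivation [f |-> sum_j v_j (d/dy_j) f(x y)] at [y = e]. *)
Lemma invariant_derivation : exists2 theta : 'I_n -> S,
  forall i, (theta i).@[e] = v i & forall f, I f -> I (\sum_i theta i * f^`M(i)).
Proof.
have iI := gen_is_ideal B.
exists (fun i => E (hcomul H 'X_i)) => [i|f If].
  have dv u : I u -> \sum_j u^`M(j).@[e] * v j = 0.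
    move=> Iu; suff [] : vanish e u /\ \sum_j u^`M(j).@[e] * v j = 0 by [].
    apply: (gen_least (Q := fun u => vanish e u /\ \sum_j u^`M(j).@[e] * v j = 0)) Iu.
      split=> [|x y [x0 dx] [y0 dy]|a x [x0 dx]]; split.
      - exact: (ideal0 (vanish_ideal e)).
      - by rewrite big1 // => j _; rewrite linear0 meval0 mul0r.
      - exact: (idealD (vanish_ideal e)).
      - under eq_bigr do rewrite mderivD mevalD mulrDl.
        by rewrite big_split /= dx dy addr0.
      - exact: (idealMl _ (vanish_ideal e)).
      - under eq_bigr do rewrite mderivM mevalD !mevalM x0 mulr0 add0r -mulrA.
        by rewrite -mulr_sumr dx mulr0.
    by move=> b bB; split; [exact/ideal_unit/mem_gen | exact: tanv].
  have := dv _ (comul_counitl 'X_i).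
  under eq_bigr do rewrite mderivB mevalB mulrBl; rewrite sumrB -E_pt.
  move/eqP; rewrite subr_eq0 => /eqP ->.
  rewrite (bigD1 i) //= mderivXU eqxx meval1 mul1r big1 ?addr0 // => j /negPf ji.
  by rewrite mderivXU eq_sym ji meval0 mul0r.
have := E_ideal (hopf_comul_ideal (hopfP H) If).
rewrite lrmorph_subst E_subst => IE.
(* The chain rule for [E (hcomul H f)] has coefficients
   [xe (hcomul H f^]M(i))[; the right counit identifies them with]f^[M(i)] modulo [I]. *)
have -> : \sum_i E (hcomul H 'X_i) * f^`M(i) =
  \sum_i xe (subst (fun i => hcomul H 'X_i) f^`M(i)) * E (hcomul H 'X_i)
  - \sum_i (xe (hcomul H f^`M(i)) - f^`M(i)) * E (hcomul H 'X_i).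
  rewrite -sumrB; apply: eq_bigr => i _.
  by rewrite -lrmorph_subst; ring.
apply: (idealB iI) => //; apply: ideal_sum => // i _.
by apply: (idealMr _ iI); exact: comul_counitr.
Qed.

End Derivation.

(** * From the unit to all points by translation *)

Section Translation.
Local Notation N := (in_gen_ideal (gens2 B)).
Local Notation Ix := (in_gen_ideal (map inl B)).
Local Notation Iy := (in_gen_ideal (map inr B)).
Local Notation D := (hcomul H).
Local Notation sg := (hantip H).

Let iN : is_ideal N. Proof. exact: gen_is_ideal. Qed.
Let iX : is_ideal Ix. Proof. exact: gen_is_ideal. Qed.
Let iY : is_ideal Iy. Proof. exact: gen_is_ideal. Qed.

Let N_add p : N p -> ideal_add Ix Iy p.
Proof.
apply: gen_least (ideal_add_ideal iX iY) _ => b; rewrite mem_cat => /orP[] bB.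
  by apply: ideal_addl => //; exact: mem_gen.
by apply: ideal_addr => //; exact: mem_gen.
Qed.

Let IxN p : Ix p -> N p.
Proof. by apply: gen_mono => b bB; rewrite mem_cat bB. Qed.

Let IyN p : Iy p -> N p.
Proof. by apply: gen_mono => b bB; rewrite mem_cat bB orbT. Qed.

(* The point (x y) y^-1, where y^-1 is the antipode of the second factor. *)
Local Notation Y := (subst (pair_pt (fun i => D 'X_i) (fun i => inr (sg 'X_i)))).

Let Y_inr f : Y (inr f) = inr (sg f).
Proof.
rewrite subst_pair_inr [in RHS]lrmorph_subst tens_inrE subst_subst.
by apply: eq_subst => i; rewrite tens_inrE.
Qed.

(** Coassociativity rewrites (x y) y^-1 as x (y y^-1); the antipode axiom reduces the second factor
    to the unit, and the counit axiom leaves x. *)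
Lemma mul_mulV f : N (Y (D f) - inl f).
Proof.
(* [Psi] restricts functions of (x, y, z) to z = y^-1. It is introduced through an existential
   statement so that only these properties of it are visible. *)
have [Psi [PsiS Psi0 Psi1 Psi2 Psi3]] : exists Psi : {rmorphism {mpoly k[n + n + n]} -> S2},
    [/\ forall m l (u : 'I_m -> _) (v : 'I_l -> _) p,
          Psi (subst (pair_pt u v) p) = subst (pair_pt (Psi \o u) (Psi \o v)) p,
        forall p, Psi (tens_inl n p) = p, forall g, Psi (tens3_1 g) = inl g,
        forall g, Psi (tens3_2 g) = inr g & forall g, Psi (tens3_3 g) = inr (sg g)].
  exists (subst (pair_pt (fun j => 'X_j : S2) (fun i => inr (sg 'X_i)))); split.
  - by move=> m l u v p; exact: subst_pair.
  - by move=> p /=; rewrite subst_pair_inl subst_id.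
  - by move=> g /=; rewrite subst_pair_inl subst_id.
  - by move=> g /=; rewrite subst_pair_inl subst_id.
  - move=> g /=; rewrite subst_pair_inr [in RHS]lrmorph_subst tens_inrE subst_subst.
    by apply: eq_subst => i; rewrite tens_inrE.
have := hopf_coassoc (hopfP H) f; rewrite /eq_mod_gen !tens_elimE => coassoc.
have : N (Psi (subst (pair_pt (fun i => tens_inl n (D 'X_i)) (fun i => tens3_3 'X_i)) (D f))
        - Psi (subst (pair_pt (fun i => tens3_1 'X_i)
            (fun i => tens_elim (@tens3_2 k n) (@tens3_3 k n) (D 'X_i))) (D f))).
  rewrite -[X in N X]rmorphB; apply: (gen_least (Q := N \o Psi)) coassoc.
    exact: ideal_preim.
  move=> b; rewrite !mem_cat => /or3P[] /mapP[c cB ->] /=.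
  - by rewrite Psi1; apply/IxN/inl_mem/mem_gen.
  - by rewrite Psi2; apply/IyN/inr_mem/mem_gen.
  - rewrite Psi3; apply/IyN/inr_mem/(hopf_antip_ideal (hopfP H))/mem_gen; exact: cB.
have PsiE m l (u : 'I_m -> _) (v : 'I_l -> _) u' v' p : Psi \o u = u' -> Psi \o v = v' ->
    Psi (subst (pair_pt u v) p) = subst (pair_pt u' v') p by move=> <- <-; exact: PsiS.
pose w i := Psi (tens_elim (@tens3_2 k n) (@tens3_3 k n) (D 'X_i)).
rewrite (PsiE _ _ _ _ (fun i => D 'X_i) (fun i => inr (sg 'X_i))); last 2 first.
- by apply/funext => i /=; exact: Psi0.
- by apply/funext => i /=; exact: Psi3.
rewrite (PsiE _ _ _ _ (fun i => inl 'X_i) w) //; last by apply/funext => i /=; exact: Psi1.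
set p := subst _ (D f); set q := subst _ (D f) => Npq.
have Nw i : N (w i - (unit_pt i)%:MP).
  have -> : w i = inr (tens_elim id sg (D 'X_i)).
    rewrite /w !tens_elimE tens_inrE subst_pair; apply: PsiE; apply/funext => j /=.
      by rewrite Psi2 tens_inrE.
    by rewrite Psi3 tens_inrE.
  have -> : (unit_pt i)%:MP = inr (unit_pt i)%:MP by rewrite tens_inrE mmapC.
  rewrite -[_ - _]rmorphB; apply/IyN/inr_mem.
  exact: (hopf_antipr (hopfP H) 'X_i).
have Nqr : N (q - subst (pair_pt (fun i => inl 'X_i) ec) (D f)).
  apply: subst_mod => //; apply: ord_split_ind => i; rewrite ?pair_ptl ?pair_ptr //.
  by rewrite subrr; exact: (ideal0 iN).
have Nrf : N (subst (pair_pt (fun i => inl 'X_i) ec) (D f) - inl f).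
  have -> : subst (pair_pt (fun i => inl 'X_i) ec) (D f) =
      inl (subst (pair_pt (fun i => 'X_i) ec) (D f)).
    rewrite (tens_inlE n (subst _ _)) subst_pair; apply: eq_subst_pair => i.
      by rewrite tens_inlE.
    by rewrite mmapC.
  by rewrite -[_ - _]rmorphB; apply/IxN/inl_mem/comul_counitr.
exact: (idealB_trans iN Npq (idealB_trans iN Nqr Nrf)).
Qed.

(* At the point z = x y, [1 - h] measures the failure of [z - s z] to lie on
   the scheme modulo squares; multiplying by y^-1 carries this failure to the
   point x, and substituting y := x^-1 turns [h z] into [h e = 1]. *)
Lemma split_everywhere h (s : 'I_n -> S) :
    h.@[e] = 1 -> (forall i, I (s i)) -> (forall f, I f -> splits I h s f) ->
  exists2 s' : 'I_n -> S, forall i, I (s' i) & forall f, I f -> splits I 1 s' f.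
Proof.
move=> he sI hs; have iI := gen_is_ideal B.
have iN2 := ideal_mul_ideal N N; have iI2 := ideal_mul_ideal I I.
pose c := ideal_add (ideal_mul N N) Iy.
have ic : is_ideal c by apply: ideal_add_ideal.
have N2c p : ideal_mul N N p -> c p by move=> Np; exact: ideal_addl.
have ND f : I f -> N (D f) by move=> If; exact: (hopf_comul_ideal (hopfP H) If).
pose z' i := D 'X_i - D (s i).
have z'E f : I f -> ideal_mul N N (subst z' f - (1 - D h) * D f).
  move=> If; have := @mpoly_taylor k S2 n (@mpolyC _ k) (fun i => D 'X_i)
    (fun i => - D (s i)) _ iN2 _ f.
  rewrite -!lrmorph_subst; under eq_bigr do rewrite -lrmorph_subst mulrN.
  rewrite sumrN opprK => taylor.
  have := ideal_mul_morph (phi := D) ND ND (hs f If).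
  rewrite rmorphB rmorphM rmorph_sum /=; under eq_bigr do rewrite rmorphM.
  move=> sp; have alg (x y t u : S2) : x - (1 - u) * y = x - y + t + (u * y - t) by ring.
  rewrite (alg _ _ (\sum_i D f^`M(i) * D (s i))).
  apply: (idealD iN2) sp; apply: taylor => i j.
  by rewrite mulrNN; apply: ideal_mul_in; apply: ND.
pose Y' := subst (pair_pt z' (fun i => inr (sg 'X_i))).
have Y'Y p : N (Y' p - Y p).
  apply: subst_mod => //; apply: ord_split_ind => i; rewrite ?pair_ptl ?pair_ptr.
    by rewrite /z' addrAC subrr add0r; apply: idealN => //; exact: ND.
  by rewrite subrr; exact: (ideal0 iN).
have Y'E p : N p -> c (Y' p - (1 - D h) * Y p).
  move=> Np; suff [] : c (Y' p - (1 - D h) * Y p) /\ N (Y p) by [].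
  apply: (gen_least (Q := fun p => c (Y' p - (1 - D h) * Y p) /\ N (Y p))) Np => [|b].
    split=> [|p1 p2 [c1 N1] [c2 N2]|a p1 [c1 N1]]; split.
    - by rewrite /Y' !rmorph0 mulr0 subrr; exact: (ideal0 ic).
    - by rewrite rmorph0; exact: (ideal0 iN).
    - by rewrite /Y' !rmorphD mulrDr opprD addrACA; exact: (idealD ic c1 c2).
    - by rewrite rmorphD; exact: (idealD iN N1 N2).
    - have alg (x y z t u : S2) : x * y - u * (z * t) = x * (y - u * t) + (x - z) * (u * t).
        by ring.
      rewrite /Y' !rmorphM alg.
      apply: (idealD ic); first exact: (idealMl _ ic).
      by apply: N2c; apply: ideal_mul_in => //; exact: (idealMl _ iN).
    - by rewrite rmorphM; exact: (idealMl _ iN).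
  rewrite mem_cat => /orP[] /mapP[b' b'B ->].
    rewrite /Y' !subst_pair_inl -lrmorph_subst; split; last exact/ND/mem_gen.
    by apply: N2c; apply: z'E; exact: mem_gen.
  have YIy : Iy (inr (sg b')).
    by apply/inr_mem/(hopf_antip_ideal (hopfP H))/mem_gen.
  rewrite Y_inr; split; last exact: IyN.
  rewrite /Y' subst_pair_inr -(subst_pair_inr (fun i => D 'X_i)) Y_inr.
  apply: (idealB ic); first exact: ideal_addr.
  by apply: (idealMl _ ic); exact: ideal_addr.
have inlE g : inl g = subst (fun i => inl 'X_i) g.
  rewrite (tens_inlE n g); apply: eq_subst => i.
  by rewrite tens_inlE mmapX mmap1U.
have near (w : 'I_n -> S2) f : (forall i, N (w i - inl 'X_i)) ->
    ideal_mul N N (subst w f - inl f - \sum_i inl f^`M(i) * (w i - inl 'X_i)).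
  move=> Nw; have := @mpoly_taylor k S2 n (@mpolyC _ k) (fun i => inl 'X_i)
    (fun i => w i - inl 'X_i) _ iN2 _ f.
  rewrite -inlE; under eq_bigr do rewrite -inlE.
  rewrite (_ : (fun i => _ + _) = w); last by apply/funext => i; rewrite addrC subrK.
  by apply=> i j; apply: ideal_mul_in.
pose w i := Y (D 'X_i); pose w' i := Y' (D 'X_i).
have Nw i : N (w i - inl 'X_i) by exact: mul_mulV.
have Nw' i : N (w' i - inl 'X_i).
  rewrite -[w' i](subrK (w i)) -addrA; apply: (idealD iN) => //; exact: Y'Y.
(* Expanding f((x y) y^-1) and f(z' y^-1) to first order at x turns [Y'E] into a splitting relation
   at x with factor h(x y) and vectors [r i], modulo [c]. *)
pose r i := (1 - D h) * (w i - inl 'X_i) - (w' i - inl 'X_i).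
have rE f : I f -> c (D h * inl f - \sum_i inl f^`M(i) * r i).
  move=> If; have := Y'E _ (ND f If); rewrite [D f]lrmorph_subst.
  rewrite [Y _]subst_subst [Y' _]subst_subst => cf.
  have -> : \sum_i inl f^`M(i) * r i =
      (1 - D h) * (\sum_i inl f^`M(i) * (w i - inl 'X_i))
      - \sum_i inl f^`M(i) * (w' i - inl 'X_i).
    rewrite mulr_sumr -sumrB; apply: eq_bigr => i _; rewrite /r mulrBr.
    by rewrite [inl _ * (_ * _)]mulrCA.
  have alg (x y z t t' a : S2) : a * z - ((1 - a) * t - t') =
      x - (1 - a) * y - (x - z - t') + (1 - a) * (y - z - t) by ring.
  rewrite (alg (subst w' f) (subst w f)).
  apply: (idealD ic); last exact: (idealMl _ ic (N2c _ (near w f Nw))).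
  exact: (idealB ic cf (N2c _ (near w' f Nw'))).
(* Only the part of [r i] in the ideal of the first factor is kept; the rest is absorbed by [c]. *)
have /choice[r1 r1P] : forall i, exists r1, Ix r1 /\ Iy (r i - r1).
  move=> i; have [|x [y [Ixx Iyy rxy]]] := @N_add (r i).
    by apply: (idealB iN) => //; exact: (idealMl _ iN).
  by exists x; rewrite rxy addrAC subrr add0r.
have [Phi [PhiI PhiX PhiY Phi1]] : exists Phi : {rmorphism S2 -> S},
    [/\ forall g, Phi (inl g) = g, forall p, Ix p -> I (Phi p),
        forall p, Iy p -> I (Phi p) & I (Phi (D h) - 1)].
  exists (subst (pair_pt (fun i => 'X_i) (fun i => sg 'X_i))); split=> [g|p|p|] /=.
  - by rewrite subst_pair_inl subst_id.
  - apply: (gen_least (Q := I \o subst _)) => [|_ /mapP[b bB ->]] /=; first exact: ideal_preim.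
    by rewrite subst_pair_inl subst_id; exact: mem_gen.
  - apply: (gen_least (Q := I \o subst _)) => [|_ /mapP[b bB ->]] /=; first exact: ideal_preim.
    rewrite subst_pair_inr -lrmorph_subst.
    by apply: (hopf_antip_ideal (hopfP H)); exact: mem_gen.
  - by have := hopf_antipr (hopfP H) h; rewrite /eq_mod_gen tens_elimE counitE he mpolyC1.
exists (fun i => Phi (r1 i)) => [i|f If]; first by apply: PhiX; case: (r1P i).
pose u := D h * inl f - \sum_i inl f^`M(i) * r1 i.
have Iu : Ix u.
  apply: (idealB iX); first by apply: (idealMl _ iX); exact: inl_mem.
  by apply: ideal_sum => // i _; apply: (idealMl _ iX); case: (r1P i).
have cu : c u.
  have -> : u = (D h * inl f - \sum_i inl f^`M(i) * r i)
      + \sum_i inl f^`M(i) * (r i - r1 i).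
    under [X in _ + X]eq_bigr do rewrite mulrBr.
    by rewrite sumrB addrA subrK.
  apply: (idealD ic); first exact: rE.
  apply: ideal_sum => // i _; apply: (idealMl _ ic (ideal_addr iN2 _)).
  by case: (r1P i).
(* Modulo [Iy], the square of [N] reduces to that of [Ix]. The remainder [u2] lies in both [Ix] and
   [Iy], hence in their product by [tens_ideal_cap], and [Phi] sends both pieces into the square of
   [I]. *)
have [u1 [u2 [u1X u2Y uE]]] : ideal_add (ideal_mul Ix Ix) Iy u.
  have iXX := ideal_mul_ideal Ix Ix; have iT := ideal_add_ideal iXX iY.
  case: cu => x [y [xN yY ->]]; apply: (idealD iT); last exact: ideal_addr.
  apply: xN => // p q /N_add[p1 [p2 [p1X p2Y ->]]] /N_add[q1 [q2 [q1X q2Y ->]]].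
  rewrite mulrDl mulrDr -addrA; apply: (idealD iT).
    by apply: ideal_addl => //; exact: ideal_mul_in.
  exact: (ideal_addr iXX (idealD iY (idealMl p1 iY q2Y) (idealMr _ iY p2Y))).
have u2X : Ix u2.
  have -> : u2 = u - u1 by rewrite uE addrAC subrr add0r.
  exact: (idealB iX Iu (ideal_mulSl iX u1X)).
have PhiU : ideal_mul I I (Phi u).
  rewrite uE rmorphD; apply: (idealD iI2).
    exact: (ideal_mul_morph PhiX PhiX u1X).
  exact: (ideal_mul_morph PhiX PhiY (tens_ideal_cap u2X u2Y)).
have PhiE : Phi u = Phi (D h) * f - \sum_i f^`M(i) * Phi (r1 i).
  rewrite /u rmorphB; congr (_ - _); first by rewrite rmorphM; congr (_ * _); exact: PhiI.
  rewrite rmorph_sum; apply: eq_bigr => i _.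
  by rewrite rmorphM; congr (_ * _); exact: PhiI.
have alg (a t : S) : 1 * f - t = a * f - t - (a - 1) * f by ring.
rewrite /splits (alg (Phi (D h))) -PhiE.
by apply: (idealB iI2) => //; exact: ideal_mul_in.
Qed.

End Translation.

End Hopf.

(** * Smoothness *)

Section Lifting.
Variables (k : fieldType) (n : nat) (H : hopf_quadruple k n).
Local Notation S := {mpoly k[n]}.
Local Notation B := (hgens H).
Local Notation I := (in_gen_ideal B).
Local Notation A := (coord_ring H).

Lemma coord_pi_eq0 f : coord_pi H f = 0 <-> I f.
Proof.
by rewrite -{1}(rmorph0 (coord_pi H)) coord_pi_eq /eq_mod_gen subr0.
Qed.

Lemma coord_ring_presented : finitely_presented A.
Proof.
exists n, B, (coord_pi H : {lrmorphism S -> A}); split; first exact: coord_pi_surj.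
exact: coord_pi_eq0.
Qed.

Lemma coord_lift (C : comAlgType k) (ev : {lrmorphism S -> C}) :
  (forall f, I f -> ev f = 0) -> exists v : {lrmorphism A -> C}, forall f, v (coord_pi H f) = ev f.
Proof.
move=> evI; have /choice[rep repK] := @coord_pi_surj _ _ H.
pose v a := ev (rep a).
have vE f : v (coord_pi H f) = ev f.
  apply/eqP; rewrite -subr_eq0 -rmorphB; apply/eqP/evI/coord_pi_eq0.
  by rewrite rmorphB /= repK subrr.
have vz : zmod_morphism v.
  by move=> a b; rewrite -(repK a) -(repK b) -rmorphB !vE rmorphB.
have vm : monoid_morphism v.
  split; first by rewrite -(rmorph1 (coord_pi H)) vE rmorph1.
  by move=> a b; rewrite -(repK a) -(repK b) -rmorphM !vE rmorphM.
have vs : scalable v.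
  by move=> c a; rewrite -(repK a) -linearZ !vE linearZ.
pose vL : {lrmorphism A -> C} := HB.pack v
  (GRing.isZmodMorphism.Build A C v vz) (GRing.isMonoidMorphism.Build A C v vm)
  (GRing.isScalable.Build k A C *:%R v vs).
by exists vL.
Qed.

Lemma mmap_alg_scalable (C : comAlgType k) (x : 'I_n -> C) :
  scalable (mmap (in_alg C) x : S -> C).
Proof. by move=> c f; rewrite mmapZ /= mulr_algl. Qed.

(** Lift the variables arbitrarily to x and correct to y = x - s(x). By Taylor, f(y) is the image of
    f - sum_i d_i f s_i, an element of I^2, and so vanishes because the kernel of [q] has square
    zero. *)
Lemma split_formally_smooth (s : 'I_n -> S) :
  (forall i, I (s i)) -> (forall f, I f -> splits I 1 s f) -> formally_smooth A.
Proof.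
move=> sI hs C D q qsurj qsq u.
have /choice[x xE] : forall i, exists x, q x = u (coord_pi H 'X_i).
  by move=> i; exact: qsurj.
have qev (y : 'I_n -> C) : (forall i, q (y i) = u (coord_pi H 'X_i)) ->
    forall f, q (mmap (in_alg C) y f) = u (coord_pi H f).
  move=> yE; apply: (mpoly_morph_ext (phi := q \o mmap (in_alg C) y)
    (psi := u \o coord_pi H)) => [c|i] /=.
    by rewrite mmapC /= linearZ /= rmorph1 -alg_mpolyC linearZ linearZ /= !rmorph1.
  by rewrite mmapX mmap1U.
pose ev1 : {rmorphism S -> C} := mmap (in_alg C) x.
have qI f : I f -> q (ev1 f) = 0.
  by move=> If; rewrite /ev1 /= (qev x xE) (coord_pi_eq0 f).2 // rmorph0.
pose y i := x i - ev1 (s i).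
have qy i : q (y i) = u (coord_pi H 'X_i).
  by rewrite rmorphB -[RHS]subr0 -xE; congr (_ - _); exact: qI.
have i0 : is_ideal (fun z : C => z = 0).
  by split=> [//|a b -> ->|a b ->]; rewrite ?addr0 ?mulr0.
have yI f : I f -> mmap (in_alg C) y f = 0.
  move=> If; have := @mpoly_taylor k C n (in_alg C) x (fun i => - ev1 (s i)) _ i0 _ f.
  rewrite -[X in X - _ - _]/(mmap _ y f) => taylor.
  have s0 : ev1 (1 * f - \sum_i f^`M(i) * s i) = 0.
    apply: (hs f If (fun z => ev1 z = 0)) => [|a b Ia Ib].
      exact: (ideal_preim ev1 i0).
    by rewrite rmorphM; apply: qsq; exact: qI.
  rewrite rmorphB mul1r rmorph_sum in s0.
  have <- : ev1 f - \sum_i ev1 (f^`M(i) * s i) = mmap (in_alg C) y f; last exact: s0.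
  have /eqP : mmap (in_alg C) y f - ev1 f - \sum_i ev1 f^`M(i) * - ev1 (s i) = 0.
    by apply: taylor => i j; rewrite mulrNN; apply: qsq; exact: qI.
  rewrite -addrA -opprD subr_eq0 => /eqP ->; congr (_ + _).
  by rewrite -sumrN; apply: eq_bigr => i _; rewrite mulrN; congr (- _); exact: rmorphM.
pose ev2 : {lrmorphism S -> C} := HB.pack (mmap (in_alg C) y)
  (GRing.RMorphism.class (mmap (in_alg C) y : {rmorphism S -> C}))
  (GRing.isScalable.Build k S C *:%R (mmap (in_alg C) y) (mmap_alg_scalable y)).
have [v vE] := coord_lift (ev := ev2) yI.
exists v => a; have [f <-] := coord_pi_surj a.
by rewrite vE; exact: qev.
Qed.

End Lifting.

Local Close Scope ring_scope.

Theorem theorem3p19 (n d : nat) :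
  exists p0 : nat, prime p0 /\
    forall (k : closedFieldType) (p : nat),
      p \in [pchar k]%R -> p0 <= p ->
      forall H : hopf_quadruple k n, complexity_le d H ->
        smooth (coord_ring H).
Proof.
have [N0 uniform] := uniform_order n d.
(* A characteristic of at least [p0] exceeds [N0], so the integers 1, ..., N0 - 1 that Cartier's
   argument divides by are invertible. *)
have [p0 ltNp0 prp0] := prime_above N0.
exists p0; split=> // k p charp le_p0p H [szB _ _ _].
split; first exact: coord_ring_presented.
pose e := unit_pt H.
have Be b : b \in hgens H -> vanish e b by move=> bB; exact/ideal_unit/mem_gen.
have [|h [s [he sI hs]]] := @local_splitting k n e (hgens H).
  (* The system [gvec] consists of scalar combinations of the generators, so it obeys the same
     degree bound; order [N0], obtained from [cartier], then yields every order. *)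
  move=> b bB; apply: (uniform k e (fun i => gvec e (hgens H) i 0%R)
    (fun i j => tproj e (hgens H) i j)) => //.
  - by move=> i; apply: gvec_size.
  - exact: szB.
  - by move=> i; apply: (I_vanish Be); exact: gvec_mem.
  - by move=> i; exact: gvec_projE.
  - by move=> i j; exact: gvec_deriv.
  apply: (cartier Be) => [v tanv|m /andP[m0 ltm]|].
  - exact: invariant_derivation.
  - rewrite -(dvdn_pcharf charp) gtnNdvd //.
    exact: leq_trans (ltn_trans ltm ltNp0) le_p0p.
  - exact: mem_gen.
have [s' s'I hs'] := split_everywhere he sI hs.
exact: split_formally_smooth s'I hs'.
Qed.
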